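(* Let $n\geq 1$ and let $u$ and $v$ be univariate diffeomorphisms on $\mathrm{SPD}(n)$. Let $g^+$ and $g^-$ be the deformed-Euclidean metrics on $\mathrm{SPD}(n)$ associated with $u$ and $v$ respectively. Then the balanced bilinear form $g^0$ of $g^+$ and $g^-$, taken with respect to the Frobenius inner product, is a Riemannian metric on $\mathrm{SPD}(n)$.
   Context: $\mathrm{Sym}(n)$ is the space of real symmetric $n\times n$ matrices and $\mathrm{SPD}(n)\subset\mathrm{Sym}(n)$ the manifold of symmetric positive definite matrices, with $T_\Sigma\mathrm{SPD}(n)\simeq\mathrm{Sym}(n)$. A univariate map is a map $f:\mathrm{SPD}(n)\to\mathrm{Sym}(n)$ for which there is a function, also denoted $f:(0,\infty)\to\mathbb{R}$, such that $f(PDP^\top)=P\,\mathrm{Diag}(f(d_1),\dots,f(d_n))\,P^\top$ for all orthogonal $P$ and all $D=\mathrm{Diag}(d_1,\dots,d_n)$ with $d_i>0$. All univariate maps are assumed smooth. A univariate diffeomorphism is a smooth univariate map which is a diffeomorphism onto its image (both as a map on $\mathrm{SPD}(n)$ and as a map on $(0,\infty)$). The deformed-Euclidean metric associated with a univariate diffeomorphism $u$ is the pullback of the Euclidean metric: $g_\Sigma(X,Y)=\mathrm{tr}(d_\Sigma u(X)\,d_\Sigma u(Y))$. It is flat, and its parallel transport does not depend on the curve. Given two flat Riemannian metrics $g^+,g^-$ on $\mathrm{SPD}(n)$ with (path-independent) Levi-Civita parallel transports $\Pi^+,\Pi^-$, the balanced bilinear form with respect to the Frobenius inner product is $g^0_\Sigma(X,Y)=\mathrm{tr}\big((\Pi^+_{\Sigma\to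 I_n}X)(\Pi^-_{\Sigma\to I_n}Y)\big)$ for $\Sigma\in\mathrm{SPD}(n)$, $X,Y\in T_\Sigma\mathrm{SPD}(n)$, where $I_n$ is the identity matrix. *)

(* Defs.v *)
From HB Require Import structures.
From mathcomp Require Import all_boot all_order all_algebra.
From mathcomp Require Import all_classical all_reals all_analysis.

Set Implicit Arguments.
Unset Strict Implicit.
Unset Printing Implicit Defensive.

Import Order.TTheory GRing.Theory Num.Theory.
Import numFieldNormedType.Exports.

Local Open Scope classical_set_scope.
Local Open Scope ring_scope.

(* Sym(n) is a type of its own, so that SPD(n) is an open set of a normed space
   and the library's differentials are differentials along symmetric directions.
   The norm is the one inherited from 'M[R]_n; in finite dimension all norms
   define the same notions of open set, derivative and smoothness. *)

Section Sym.
Variables (R : realType) (n : nat).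

Definition symmx : {pred 'M[R]_n} := fun S => S \is symmetricmx.

Lemma symmxE (S : 'M[R]_n) : (S \in symmx) = (S == S^T).
Proof. by rewrite unfold_in is_hermitianmxE expr0 scale1r map_mx_id. Qed.

Fact symmx_submod : submod_closed symmx.
Proof.
split=> [|a S T]; first by rewrite symmxE trmx0.
by rewrite !symmxE linearP /= => /eqP <- /eqP <-.
Qed.

HB.instance Definition _ :=
  GRing.isSubmodClosed.Build R 'M[R]_n symmx symmx_submod.

Record sym := Sym { symval :> 'M[R]_n; _ : symval \in symmx }.

HB.instance Definition _ := [isSub for symval].
HB.instance Definition _ := [Choice of sym by <:].
HB.instance Definition _ := [SubChoice_isSubLmodule of sym by <:].

Definition sym_norm (S : sym) : R := `|symval S|.

Fact sym_normD (S T : sym) : sym_norm (S + T) <= sym_norm S + sym_norm T.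
Proof. exact: ler_normD. Qed.

Fact sym_normZ (a : R) (S : sym) : sym_norm (a *: S) = `|a| * sym_norm S.
Proof. exact: normrZ. Qed.

Fact sym_norm_eq0 (S : sym) : sym_norm S = 0 -> S = 0.
Proof. by move=> /normr0_eq0 S0; exact: val_inj. Qed.

HB.instance Definition _ :=
  Lmodule_isNormed.Build R sym sym_normD sym_normZ sym_norm_eq0.

Fact sym1_subproof : (1%:M : 'M[R]_n) \in symmx.
Proof. by rewrite symmxE trmx1. Qed.

Definition sym1 : sym := Sym sym1_subproof.

Definition SPD : set sym :=
  [set S | forall x : 'rV[R]_n, x != 0 -> 0 < (x *m S *m x^T) 0 0].

End Sym.

Section Smooth.
Variables (R : realType) (V W : normedModType R).

(* For finite-dimensional V and open U this is the usual C^k: all iterated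
   directional derivatives of order at most k exist and are continuous on U. *)
Fixpoint Ck (k : nat) (U : set V) (f : V -> W) : Prop :=
  match k with
  | 0 => forall x, U x -> {for x, continuous f}
  | k'.+1 => (forall x, U x -> differentiable f x) /\
             (forall h : V, Ck k' U ('D_h f))
  end.

Definition smooth_on (U : set V) (f : V -> W) : Prop := forall k, Ck k U f.

End Smooth.

(* V and W have the same dimension whenever this is used, so the image of a
   diffeomorphism onto its image is necessarily open. *)
Definition diffeo_onto_image (R : realType) (V W : normedModType R)
    (U : set V) (f : V -> W) : Prop :=
  [/\ smooth_on U f,
      open (f @` U) &
      exists2 f' : W -> V, smooth_on (f @` U) f' &
                           forall x, U x -> f' (f x) = x].

Section Univariate.
Variables (R : realType) (n : nat).

(* Maps on SPD(n) and on (0, +oo) are represented by total functions whose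
   values elsewhere are irrelevant. *)
Definition univariate (u : sym R n -> sym R n) (f : R -> R) : Prop :=
  forall (P : 'M[R]_n) (d : 'rV[R]_n) (S : sym R n),
    P *m P^T = 1%:M -> (forall i, 0 < d 0 i) ->
    symval S = P *m diag_mx d *m P^T ->
    symval (u S) = P *m diag_mx (map_mx f d) *m P^T.

Definition univariate_diffeo (u : sym R n -> sym R n) : Prop :=
  exists f : R -> R,
    [/\ univariate u f,
        diffeo_onto_image (@SPD R n) u &
        diffeo_onto_image [set x : R | 0 < x] f].

End Univariate.

Section Metrics.
Variables (R : realType) (n : nat).
Local Notation sym := (sym R n).
Local Notation SPD := (@SPD R n).

(* A field of bilinear forms on SPD(n), written S |-> g S in the global chart
   given by the inclusion of SPD(n) in Sym(n). *)
Definition form_field := sym -> sym -> sym -> R.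

Definition riemannian_metric (g : form_field) : Prop :=
  [/\ forall S, SPD S -> bilinear_for *%R *%R (g S),
      forall S X Y, SPD S -> g S X Y = g S Y X,
      forall S X, SPD S -> X != 0 -> 0 < g S X X &
      forall X Y, smooth_on SPD (fun S => g S X Y)].

Definition deformed_euclidean (u : sym -> sym) : form_field :=
  fun S X Y => \tr (symval ('d u S X) *m symval ('d u S Y)).

(* Gamma stands for the connection whose covariant derivative along X of a
   vector field Y is S |-> 'D_(X S) Y S + Gamma S (X S) (Y S).  It is the
   Levi-Civita connection when it is torsion-free and compatible with g; this is
   stated on constant vector fields, which span the vector fields over the
   functions on SPD(n).  For a Riemannian metric, the Koszul formula shows that
   these conditions determine Gamma on SPD(n) and make it smooth. *)
Definition levi_civita (g : form_field) (Gamma : sym -> sym -> sym -> sym) :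
    Prop :=
  forall S, SPD S ->
    [/\ bilinear_for *:%R *:%R (Gamma S),
        forall X Y, Gamma S X Y = Gamma S Y X &
        forall X Y Z, 'D_X (fun T => g T Y Z) S =
                      g S (Gamma S X Y) Z + g S Y (Gamma S X Z)].

Definition smooth_curve (S T : sym) (c : R -> sym) : Prop :=
  [/\ smooth_on setT c,
      forall t, 0 <= t <= 1 -> SPD (c t),
      c 0 = S & c 1 = T].

Definition parallel_along (g : form_field) (c X : R -> sym) : Prop :=
  exists2 Gamma, levi_civita g Gamma &
    forall t : R, 0 <= t <= 1 ->
      is_derive t 1 X (- Gamma (c t) ('D_1 c t) (X t)).

Definition is_transport (g : form_field) (S T X Y : sym) : Prop :=
  forall c, smooth_curve S T c ->
    exists2 Xc : R -> sym, parallel_along g c Xc & Xc 0 = X /\ Xc 1 = Y.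

(* The path-independent Levi-Civita parallel transport from S to T; the default
   value 0 is only taken when there is no such transport. *)
Definition transport (g : form_field) (S T X : sym) : sym :=
  xget 0 [set Y | is_transport g S T X Y].

Definition balanced_form (gp gm : form_field) : form_field :=
  fun S X Y => \tr (symval (transport gp S (sym1 R n) X) *m
                    symval (transport gm S (sym1 R n) Y)).

End Metrics.

(* Main.v *)
Require Import Defs.
From HB Require Import structures.
From mathcomp Require Import all_boot all_order all_algebra.
From mathcomp Require Import all_classical all_reals all_analysis.
From mathcomp Require Import ring lra.

Set Implicit Arguments.
Unset Strict Implicit.
Unset Printing Implicit Defensive.

Import Order.TTheory GRing.Theory Num.Theory.
Import numFieldNormedType.Exports.

Local Open Scope classical_set_scope.
Local Open Scope ring_scope.

(** A univariate diffeomorphism u, with inverse w on its open image, pulls the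
    Euclidean structure of Sym(n) back to a flat metric on SPD(n).  Its
    Levi-Civita connection is [dw (D^2 u (X, Y))], so a field X along a curve c
    is parallel exactly when [du_c X] is constant.  Hence the transport from S
    to T is [dw_{u(T)} o du_S] whatever the curve ([transport_pullback]).

    At the identity all eigenvalues coincide, and [du_I = f'(1) id]; so, up to
    the factor [1 / (f'(1) h'(1))], the balanced form of the maps u and v, with
    scalar functions f and h, is [tr (du_S X  dv_S Y)].

    The main point is that, in an orthonormal eigenbasis of S with eigenvalues
    d_i, both du_S and dv_S act entrywise: they multiply the (i, j) entry by the
    divided difference of f, respectively h, at (d_i, d_j) (the
    Daleckii-Krein formula, [diff_univariate]).  The balanced form is therefore
    diagonal in that basis ([balanced_form_diagonal]), which gives symmetry.
    A divided difference is a value of the derivative, and f' and h' are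
    continuous without zeros on the positive half-line, so each of them keeps
    the sign it has at 1 ([divided_difference_sign]); the diagonal weights are
    therefore positive, which gives definiteness.  Smoothness holds because the
    form is a finite sum of products of entries of derivatives of u and v.

    Three classical facts are proved on the way: the symmetry of second
    derivatives ([derive_comm]), the real spectral theorem
    ([symmetric_spectral]) and the openness of SPD(n) ([open_SPD]).  One
    identity for plane rotations, [givens_conj_diag], serves both the spectral
    theorem and the computation of du_S. *)

(** * Derivatives along curves and C^k functions *)

Section Calculus.
Variables (R : realType).
Implicit Types V W : normedModType R.

(** Equalities that hold on an open set become equalities of derivatives through
    this lemma. *)
Lemma near_eq_on V W (U : set V) (f g : V -> W) (x : V) :
  open U -> U x -> (forall y, U y -> f y = g y) -> \near x, f x = g x.
Proof.
move=> oU Ux fg; near=> y; apply: fg; near: y; exact: open_nbhs_nbhs.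
Unshelve. all: by end_near. Qed.

Lemma near_curve V (U : set V) (c : R -> V) (t : R) (c' : V) :
  open U -> U (c t) -> is_derive t 1 c c' -> \forall s \near t, U (c s).
Proof.
move=> oU Uc cD; have cc : {for t, continuous c}.
  by apply/differentiable_continuous/derivable1_diffP; exact: ex_derive.
by apply: cc; exact: open_nbhs_nbhs.
Qed.

Lemma is_derive_comp V W (f : V -> W) (g : R -> V) (t : R) (v : V) :
  is_derive t 1 g v -> differentiable f (g t) ->
  is_derive t 1 (f \o g) ('d f (g t) v).
Proof.
move=> gv df; have dg : differentiable g t.
  by apply/derivable1_diffP; exact: ex_derive.
apply: DeriveDef; first by apply/diff_derivable/differentiable_comp.
rewrite deriveE; last exact: differentiable_comp.
by rewrite diff_comp //= -(deriveE _ dg) derive_val.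
Qed.

Lemma is_derive_line V (x h : V) (t : R) :
  is_derive t 1 (fun s : R => x + s *: h) h.
Proof.
have H : is_derive t 1 ((fun s : R => s *: h)) h.
  apply: DeriveDef; first exact/derivable1_diffP.
  by rewrite deriveE // diff_val scale1r.
have := is_deriveD (is_derive_cst x t (1 : R)) H.
by rewrite add0r.
Qed.

Lemma is_derive_along V W (f : V -> W) (x h : V) (t : R) :
  differentiable f (x + t *: h) ->
  is_derive t 1 (fun s => f (x + s *: h)) ('D_h f (x + t *: h)).
Proof.
move=> df; rewrite deriveE //.
exact: (is_derive_comp (is_derive_line x h t) df).
Qed.

(** The chain rule for [g \o f], which is the identity near x.  Applied to a
    diffeomorphism and to its inverse it makes the differential bijective without
    a dimension count. *)
Lemma derivative_of_inverse V W (U : set V) (f : V -> W) (g : W -> V) (x : V) :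
  open U -> U x -> (forall y, U y -> g (f y) = y) ->
  differentiable f x -> differentiable g (f x) ->
  forall h, 'd g (f x) ('d f x h) = h.
Proof.
move=> oU Ux gK df dg h.
have E : 'd (g \o f) x h = 'd g (f x) ('d f x h) by rewrite diff_comp.
rewrite -E -deriveE; last exact: differentiable_comp.
rewrite (near_eq_derive h (near_eq_on (g := idfun) oU Ux gK)).
exact: derive_id.
Qed.

Lemma CkW V W k (U : set V) (f : V -> W) : Ck k.+1 U f -> Ck k U f.
Proof.
elim: k f => [|k IH] f [df Df]; first by move=> x Ux; exact/differentiable_continuous/df.
by split=> // h; apply/IH/Df.
Qed.

Lemma near_eq_differentiable V W (f g : V -> W) (x : V) :
  (\near x, f x = g x) -> differentiable f x -> differentiable g x.
Proof.
move=> fg df; have fgx : f x = g x := nbhs_singleton fg.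
have dE : g \o shift x = cst (g x) + 'd f x +o_ 0 id.
  apply/eqaddoP => _/posnumP[e].
  have := diff_locally df => /eqaddoP /(_ e%:num (gt0 e)) H.
  near=> h; rewrite -!fgx; have -> : (g \o shift x - (cst (f x) + 'd f x)) h =
     (f \o shift x - (cst (f x) + 'd f x)) h.
    rewrite !fctE /=; congr (_ - _); apply/esym.
    by near: h; have := fg; rewrite (near_shift 0) /= subr0.
  by near: h.
have cd : continuous ('d f x) by exact: diff_continuous.
by apply/diff_locallyP; rewrite (diff_unique cd dE).
Unshelve. all: by end_near. Qed.

(** Membership in C^k over an open set is local.  The closure properties below
    need it, since rules such as the product rule hold only inside the set. *)
Lemma Ck_ext V W k (U : set V) (f g : V -> W) : open U ->
  (forall x, U x -> f x = g x) -> Ck k U f -> Ck k U g.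
Proof.
move=> oU; elim: k f g => [|k IH] f g fg.
  move=> cf x Ux; rewrite /prop_for /continuous_at -fg //.
  apply: (cvg_trans _ (cf x Ux)); apply: near_eq_cvg.
  by apply: (near_eq_on oU Ux) => y /fg.
case=> df Df; split=> [x Ux|h].
  exact: (near_eq_differentiable (near_eq_on oU Ux fg) (df x Ux)).
apply: (IH ('D_h f)); last exact: Df.
by move=> x Ux; exact: near_eq_derive (near_eq_on oU Ux fg).
Qed.

Lemma CkD V W k (U : set V) (f g : V -> W) : open U ->
  Ck k U f -> Ck k U g -> Ck k U (fun x => f x + g x).
Proof.
move=> oU; elim: k f g => [|k IH] f g.
  by move=> cf cg x Ux; apply: cvgD; [exact: cf|exact: cg].
move=> [df Df] [dg Dg]; split=> [x Ux|h].
  exact: differentiableD (df x Ux) (dg x Ux).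
apply: (@Ck_ext _ _ _ _ (fun x => 'D_h f x + 'D_h g x)) => //;
  last exact: (IH _ _ (Df h) (Dg h)).
move=> x Ux; rewrite -[RHS]/('D_h (f + g) x) deriveD //;
  apply: diff_derivable; [exact: df|exact: dg].
Qed.

Lemma Ck_cst V W k (U : set V) (a : W) : Ck k U (cst a).
Proof.
elim: k a => [a x Ux|k IH a]; first exact: cst_continuous.
split=> // h; rewrite (_ : 'D_h (cst a) = cst 0); first exact: IH.
by apply/funext => x; rewrite derive_cst.
Qed.

Lemma Ck_sum V W k (U : set V) (I : finType) (f : I -> V -> W) : open U ->
  (forall i, Ck k U (f i)) -> Ck k U (fun x => \sum_i f i x).
Proof.
move=> oU fC; elim: (index_enum I) => [|i s IH].
  apply: (@Ck_ext _ _ _ _ (cst 0)) => //; first by move=> x _; rewrite big_nil.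
  exact: Ck_cst.
apply: (@Ck_ext _ _ _ _ (fun x => f i x + \sum_(j <- s) f j x)) => //.
  by move=> x _; rewrite big_cons.
exact: CkD.
Qed.

Lemma CkM V k (U : set V) (f g : V -> R) : open U ->
  Ck k U f -> Ck k U g -> Ck k U (fun x => f x * g x).
Proof.
move=> oU; elim: k f g => [|k IH] f g.
  by move=> cf cg x Ux; apply: cvgM; [exact: cf|exact: cg].
move=> [df Df] [dg Dg]; split=> [x Ux|h].
  exact: differentiableM (df x Ux) (dg x Ux).
apply: (@Ck_ext _ _ _ _ (fun x => f x * 'D_h g x + g x * 'D_h f x)) => //.
  move=> x Ux; rewrite -[RHS]/('D_h (f * g) x) deriveM //;
    apply: diff_derivable; [exact: df|exact: dg].
have [fW gW] : Ck k U f /\ Ck k U g by split; apply: CkW; split.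
exact: (CkD oU (IH _ _ fW (Dg h)) (IH _ _ gW (Df h))).
Qed.

Lemma Ck_linear V W W' k (U : set V) (f : V -> W) (L : {linear W -> W'}) :
  open U -> continuous L -> Ck k U f -> Ck k U (L \o f).
Proof.
move=> oU cL; have dL y : differentiable L y by exact: linear_differentiable.
elim: k f => [|k IH] f.
  by move=> cf x Ux; apply: continuous_comp; [exact: cf|exact: cL].
move=> [df Df]; split=> [x Ux|h].
  by apply: differentiable_comp => //; exact: df.
apply: (@Ck_ext _ _ _ _ (L \o 'D_h f)) => //; last exact: (IH _ (Df h)).
move=> x Ux /=; rewrite !deriveE; [|exact: differentiable_comp (df x Ux) _|exact: df].
rewrite (_ : 'd (L \o f) x h = 'd L (f x) ('d f x h)); first by rewrite diff_lin.
by rewrite (diff_comp (df x Ux) (dL (f x))).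
Qed.

Lemma Ck_affine V W k (U : set V) (f : V -> W) (l : V -> W) : open U ->
  (forall x, differentiable f x) -> (forall x h, 'D_h f x = l h) -> Ck k U f.
Proof.
move=> oU df Df; case: k => [|k]; first by move=> x _; exact: differentiable_continuous.
split=> // h; rewrite (_ : 'D_h f = cst (l h)); last exact/funext.
exact: Ck_cst.
Qed.

End Calculus.

(** * Symmetry of second derivatives *)

Section Schwarz.
Variables (R : realType) (V : normedModType R).

Lemma MVT_from0 (f df : R -> R) (h : R) : 0 <= h ->
  (forall s, 0 <= s <= h -> is_derive s 1 f (df s)) ->
  exists2 s, 0 <= s <= h & f h - f 0 = df s * h.
Proof.
move=> h0 fdf; have [||s] := MVT_segment (f := f) (df := df) h0.
- by move=> s; rewrite in_itv /= => /andP[/ltW s0 /ltW sh]; apply: fdf; rewrite s0.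
- apply: derivable_within_continuous => s; rewrite in_itv /= => sI.
  by have [] := fdf s sI.
- by rewrite in_itv /= subr0 => ? ?; exists s.
Qed.

(** The mean value theorem applied twice, first in the direction X to the
    difference of two translates of g, then in the direction Y to its derivative.
    The left-hand side is symmetric in X and Y, the right-hand side is not. *)
Lemma mixed_difference (g : V -> R) (x X Y : V) (h : R) : 0 <= h ->
  (forall s t, 0 <= s <= h -> 0 <= t <= h ->
     differentiable g (x + s *: X + t *: Y) /\
     differentiable ('D_X g) (x + s *: X + t *: Y)) ->
  exists s t, [/\ 0 <= s <= h, 0 <= t <= h &
    g (x + h *: X + h *: Y) - g (x + h *: X) - g (x + h *: Y) + g x =
    'D_Y ('D_X g) (x + s *: X + t *: Y) * h * h].
Proof.
move=> h0 dg.
have hI : 0 <= h <= h by apply/andP; split.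
have zI : (0 : R) <= 0 <= h by rewrite lexx.
have [|s sI Es] := @MVT_from0 (fun s => g (x + h *: Y + s *: X) - g (x + s *: X))
  (fun s => 'D_X g (x + h *: Y + s *: X) - 'D_X g (x + s *: X)) h h0.
  move=> s sI.
  have d1 : differentiable g (x + h *: Y + s *: X).
    by rewrite addrAC; case: (dg s h sI hI).
  have d2 : differentiable g (x + s *: X).
    by have [] := dg s 0 sI zI; rewrite scale0r addr0.
  exact: (is_deriveB (is_derive_along d1) (is_derive_along d2)).
have [|t tI Et] := @MVT_from0 (fun t => 'D_X g (x + s *: X + t *: Y))
  (fun t => 'D_Y ('D_X g) (x + s *: X + t *: Y)) h h0.
  by move=> t tI; apply: is_derive_along; case: (dg s t sI tI).
exists s, t; split=> //.
rewrite -Et scale0r addr0 (addrAC x (s *: X)) -Es !scale0r !addr0 (addrAC x (h *: Y)).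
ring.
Qed.

(** Applying [mixed_difference] to (X, Y) and to (Y, X) shows that the two second
    derivatives agree at a pair of points arbitrarily close to x; continuity
    concludes. *)
Lemma derive_comm (U : set V) (g : V -> R) (x X Y : V) :
  open U -> U x -> Ck 2 U g -> 'D_X ('D_Y g) x = 'D_Y ('D_X g) x.
Proof.
move=> oU Ux [dg Dg]; apply/eqP; rewrite -subr_eq0 -normr_le0 leNgt.
apply/negP; set D := `|_| => D0.
have e0 : 0 < D / 2 by rewrite divr_gt0.
have [dX DX] := Dg X; have [dY DY] := Dg Y.
have cXY : 'D_X ('D_Y g) y @[y --> x] --> 'D_X ('D_Y g) x by exact: (DY X x Ux).
have cYX : 'D_Y ('D_X g) y @[y --> x] --> 'D_Y ('D_X g) x by exact: (DX Y x Ux).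
have nU : \near x, U x by exact: open_nbhs_nbhs.
have nXY : \forall y \near x, `|'D_X ('D_Y g) x - 'D_X ('D_Y g) y| < D / 2.
  by move/cvgrPdist_lt: cXY => /(_ _ e0).
have nYX : \forall y \near x, `|'D_Y ('D_X g) x - 'D_Y ('D_X g) y| < D / 2.
  by move/cvgrPdist_lt: cYX => /(_ _ e0).
(* If the two values at x differed by D > 0, then neither second derivative would
   vary by D / 2 on a small ball. *)
have [r /= r0 rP] := (nbhs_ballP _ _).1 (filterI nU (filterI nXY nYX)).
have [h h0 hr] : exists2 h, 0 < h & h * (`|X| + `|Y|) < r.
  have N0 : 0 < `|X| + `|Y| + 1 by rewrite ltr_wpDl // addr_ge0.
  exists (r / (`|X| + `|Y| + 1)); first by rewrite divr_gt0.
  by rewrite mulrAC ltr_pdivrMr// ltr_pM2l// ltrDl.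
have box s t : 0 <= s <= h -> 0 <= t <= h -> ball x r (x + s *: X + t *: Y).
  move=> /andP[s0 sh] /andP[t0 th]; rewrite -ball_normE /= opprD addrA opprD addrA subrr.
  rewrite add0r -opprD normrN (le_lt_trans (ler_normD _ _)) // !normrZ !ger0_norm //.
  by apply: le_lt_trans hr; rewrite mulrDr lerD // ler_wpM2r.
have h0' := ltW h0.
have [|s [t [sI tI Est]]] := @mixed_difference g x X Y h h0'.
  by move=> s t sI tI; have [Uy _] := rP _ (box s t sI tI); split; [exact: dg|exact: dX].
have boxC s' t' : 0 <= s' <= h -> 0 <= t' <= h -> ball x r (x + s' *: Y + t' *: X).
  by move=> ? ?; rewrite addrAC; exact: box.
have [|t' [s' [tI' sI' Est']]] := @mixed_difference g x Y X h h0'.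
  by move=> t' s' tI' sI'; have [Uy _] := rP _ (boxC t' s' tI' sI'); split; [exact: dg|exact: dY].
have cancel (a b p q q' o : R) :
    p - q - q' + o = a * h * h -> p - q' - q + o = b * h * h -> a = b.
  move=> Ea Eb; have h2 : h * h != 0 by rewrite mulf_neq0 // gt_eqF.
  by apply: (mulIf h2); rewrite !mulrA -Ea -Eb; ring.
rewrite [x + h *: Y + h *: X]addrAC in Est'.
have {cancel Est'}Est := cancel _ _ _ _ _ _ Est Est'.
have [_ [_ /= n1]] := rP _ (box s t sI tI).
have [_ [/= n2 _]] := rP _ (boxC t' s' tI' sI').
have : D < D / 2 + D / 2.
  rewrite {1}/D -(subrKA ('D_X ('D_Y g) (x + t' *: Y + s' *: X))).
  apply: (le_lt_trans (ler_normD _ _)); apply: ltrD; first exact: n2.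
  rewrite -Est distrC; exact: n1.
by rewrite -splitr ltxx.
Qed.
End Schwarz.

(** * Coordinates on the space of symmetric matrices *)

Lemma norm_le_linear_continuous (R : realType) (V W : normedModType R)
    (f : {linear V -> W}) : (forall x, `|f x| <= `|x|) -> continuous f.
Proof.
move=> fle x; apply/cvgrPdist_lt => e e0; near=> y.
rewrite -linearB; apply: le_lt_trans (fle _) _.
by near: y; exact: cvgr_dist_lt.
Unshelve. all: by end_near. Qed.

Section SymBasics.
Variables (R : realType) (n : nat).
Local Notation sym := (sym R n).

Lemma symval_inj : injective (@symval R n). Proof. exact: val_inj. Qed.
Lemma symvalD (S T : sym) : symval (S + T) = symval S + symval T. Proof. by []. Qed.
Lemma symvalB (S T : sym) : symval (S - T) = symval S - symval T. Proof. by []. Qed.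
Lemma symvalZ a (S : sym) : symval (a *: S) = a *: symval S. Proof. by []. Qed.
Lemma symvalT (S : sym) : (symval S)^T = symval S.
Proof. by case: S => S /=; rewrite symmxE => /eqP <-. Qed.

Lemma symvalC (S : sym) i j : symval S i j = symval S j i.
Proof. by rewrite -[in LHS]symvalT mxE. Qed.

Fact sym_of_subproof (M : 'M[R]_n) : 2^-1 *: (M + M^T) \in @symmx R n.
Proof. by rewrite symmxE; apply/eqP/matrixP => i j; rewrite !mxE addrC. Qed.

(** The symmetric part of a matrix, which makes the passage from matrices to
    [sym] total and linear. *)
Definition sym_of (M : 'M[R]_n) : sym := Sym (sym_of_subproof M).

Lemma sym_ofK (M : 'M[R]_n) : M^T = M -> symval (sym_of M) = M.
Proof. move=> MT /=; rewrite MT; apply/matrixP => i j; rewrite !mxE; lra. Qed.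

Lemma symvalK (S : sym) : sym_of (symval S) = S.
Proof. by apply: symval_inj; rewrite /= -[RHS](sym_ofK (symvalT S)). Qed.

Fact sym_of_linear : linear sym_of.
Proof.
move=> a M N; apply: symval_inj; rewrite symvalD symvalZ /=.
by apply/matrixP => i j; rewrite !mxE; ring.
Qed.

HB.instance Definition _ := GRing.isLinear.Build R 'M[R]_n sym *:%R sym_of sym_of_linear.

Definition sym_entry (i j : 'I_n) (S : sym) : R := symval S i j.

Fact sym_entry_linear i j : linear_for *%R (sym_entry i j).
Proof. by move=> a S T; rewrite /sym_entry symvalD symvalZ !mxE. Qed.

HB.instance Definition _ i j :=
  GRing.isLinear.Build R sym R *%R (sym_entry i j) (sym_entry_linear i j).

Lemma sym_entry_le i j (S : sym) : `|sym_entry i j S| <= `|S|.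
Proof.
rewrite /sym_entry [leRHS]/Num.norm /= /sym_norm [leRHS]/Num.norm /= mx_normrE.
exact: (le_bigmax _ _ (i, j)).
Qed.

Lemma continuous_sym_entry i j : continuous (sym_entry i j).
Proof. by apply: norm_le_linear_continuous; exact: sym_entry_le. Qed.

Lemma sym_entryP (S T : sym) : (forall i j, sym_entry i j S = sym_entry i j T) -> S = T.
Proof. by move=> ST; apply/symval_inj/matrixP. Qed.

Lemma sym_expand (S : sym) :
  S = \sum_i \sum_j sym_entry i j S *: sym_of (delta_mx i j).
Proof.
rewrite -[LHS]symvalK {1}[symval S]matrix_sum_delta linear_sum; apply: eq_bigr => i _ /=.
by rewrite linear_sum; apply: eq_bigr => j _ /=; rewrite linearZ.
Qed.
End SymBasics.

(** * Differentiating a differential applied to a moving vector *)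

Lemma is_deriveZr (R : realType) (W : normedModType R) (a : R -> R) (F : R -> W)
    (t da : R) (dF : W) :
  is_derive t 1 a da -> is_derive t 1 F dF ->
  is_derive t 1 (fun s => a s *: F s) (da *: F t + a t *: dF).
Proof.
move=> aD FD.
have cF : {for t, continuous F}.
  by apply/differentiable_continuous/derivable1_diffP; exact: ex_derive.
suff H : (fun h => h^-1 *: (((fun s => a s *: F s) \o shift t) (h *: (1 : R)) -
    a t *: F t)) @ 0^' --> da *: F t + a t *: dF.
  by apply: DeriveDef; [apply/cvg_ex; exists (da *: F t + a t *: dF)|exact/cvg_lim].
have Ha : (fun h => h^-1 *: ((a \o shift t) (h *: (1 : R)) - a t)) @ 0^' --> da.
  by case: aD => + <-.
have HF : (fun h => h^-1 *: ((F \o shift t) (h *: (1 : R)) - F t)) @ 0^' --> dF.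
  by case: FD => + <-.
have HFt : (fun h : R => F (h *: 1 + t)) @ 0^' --> F t.
  have : (fun h : R => F (h + t)) @ 0^' --> F t.
    apply: (@cvg_comp _ _ _ (fun h : R => h + t) F _ (nbhs t)) => //.
    suff : (fun h : R => h + t) @ 0^' --> 0 + t by rewrite add0r.
    by apply: cvgD; [exact: nbhs_dnbhs|exact: cvg_cst].
  by move=> H; apply: (cvg_trans _ H); apply: near_eq_cvg; near=> h; rewrite [h *: _]mulr1.
have H : (fun h => (h^-1 *: ((a \o shift t) (h *: 1) - a t)) *: F (h *: 1 + t) +
    a t *: (h^-1 *: ((F \o shift t) (h *: 1) - F t))) @ 0^' --> da *: F t + a t *: dF.
  apply: cvgD; first exact: (cvgZ Ha HFt).
  exact: (cvgZ (cvg_cst (a t)) HF).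
apply: (cvg_trans _ H); apply: near_eq_cvg; near=> h.
rewrite /= -[h^-1 *: (a _ - a t)]/(h^-1 * (a _ - a t)) -scalerA.
rewrite [a t *: (h^-1 *: _)]scalerA mulrC -scalerA -scalerDr; congr (_ *: _).
by rewrite scalerBl scalerBr addrA subrK.
Unshelve. all: by end_near. Qed.

Lemma is_derive_bigsum (R : realType) (V W : normedModType R) (I : finType)
    (f : I -> V -> W) (df : I -> W) (x v : V) :
  (forall i, is_derive x v (f i) (df i)) ->
  is_derive x v (fun y => \sum_i f i y) (\sum_i df i).
Proof.
move=> fD; rewrite (_ : (fun y => _) = \sum_i f i).
  by elim/big_ind2 : _ => // [|] *; [exact: is_derive_cst|exact: is_deriveD].
by apply/funext => y; rewrite fct_sumE.
Qed.

Lemma derive_linear_comp (R : realType) (V W W' : normedModType R)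
    (f : V -> W) (L : {linear W -> W'}) (x v : V) :
  continuous L -> differentiable f x -> 'D_v (L \o f) x = L ('D_v f x).
Proof.
move=> cL df; have dL y : differentiable L y by exact: linear_differentiable.
rewrite !deriveE; [|exact: df|exact: differentiable_comp].
rewrite (_ : 'd (L \o f) x v = 'd L (f x) ('d f x v)); first by rewrite diff_lin.
by rewrite (diff_comp df (dL (f x))).
Qed.

Lemma derive_linear_comm (R : realType) (V W : normedModType R) (U : set V)
    (f : V -> W) (L : {linear W -> R}) (x X Y : V) :
  continuous L -> open U -> U x -> Ck 2 U f ->
  L ('D_X ('D_Y f) x) = L ('D_Y ('D_X f) x).
Proof.
move=> cL oU Ux f2; have [df Df] := f2.
have E A B : 'D_A ('D_B (L \o f)) x = L ('D_A ('D_B f) x).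
  rewrite -derive_linear_comp //; last by have [+ _] := Df B; exact.
  apply: near_eq_derive; near=> y.
  rewrite derive_linear_comp //; apply: df; near: y; exact: open_nbhs_nbhs.
have C2 : Ck 2 U (L \o f) by exact: Ck_linear.
by rewrite -!E; exact: (@derive_comm _ _ U (L \o f) x X Y oU Ux C2).
Unshelve. all: by end_near. Qed.

(** The product rule for [(x, y) |-> 'd f x y] along a curve.  A finite system of
    linear coordinates turns it into a sum of products, so that no topology on
    the space of linear maps is required. *)
Lemma is_derive_diff_apply (R : realType) (V W : normedModType R) (U : set V)
    (I : finType) (l : I -> {linear V -> R}) (e : I -> V)
    (f : V -> W) (c X : R -> V) (t : R) (c' X' : V) :
  (forall k, continuous (l k)) -> (forall x, x = \sum_k l k x *: e k) ->
  open U -> Ck 2 U f -> U (c t) -> is_derive t 1 c c' -> is_derive t 1 X X' ->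
  is_derive t 1 (fun s => 'd f (c s) (X s))
    ('d f (c t) X' + 'D_c' ('D_(X t) f) (c t)).
Proof.
move=> cl le oU [df Df] Uc cD XD.
have nU := near_curve oU Uc cD.
have dE x Z : U x -> 'd f x Z = \sum_k l k Z *: 'D_(e k) f x.
  move=> Ux; rewrite {1}(le Z) linear_sum; apply: eq_bigr => k _.
  by rewrite linearZ deriveE //; exact: df.
apply: (@near_eq_is_derive _ _ _ (fun s => \sum_k l k (X s) *: 'D_(e k) f (c s))).
  by near=> s; rewrite dE //; near: s.
apply: is_derive_eq.
  apply: is_derive_bigsum => k; apply: is_deriveZr.
    apply: (is_derive_comp XD (f := l k)); exact: linear_differentiable.
  by apply: (is_derive_comp cD (f := 'D_(e k) f)); case: (Df (e k)) => + _; exact.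
rewrite big_split /=; congr (_ + _).
  by rewrite dE //; apply: eq_bigr => k _; rewrite diff_lin.
transitivity ('D_c' (fun x => \sum_k l k (X t) *: 'D_(e k) f x) (c t)).
  have DkD k : is_derive (c t) c' ('D_(e k) f) ('d ('D_(e k) f) (c t) c').
    have dk := (Df (e k)).1 _ Uc.
    by apply: DeriveDef; [exact: diff_derivable|exact: deriveE].
  have SD := is_derive_bigsum (fun k => is_deriveZ (l k (X t)) (DkD k)).
  by have := @derive_val _ _ _ _ _ _ _ SD; move=> /= ->.
apply: near_eq_derive; near=> x.
have Ux : U x by near: x; exact: open_nbhs_nbhs.
by rewrite deriveE ?dE //; exact: df.
Unshelve. all: by end_near. Qed.

(** * Plane rotations and the real spectral theorem *)

Section Givens.
Variables (R : realType) (n : nat).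
Implicit Types (i j : 'I_n) (c s : R).

Definition givens i j c s : 'M[R]_n :=
  \matrix_(a, b) if b == i then c * (a == i)%:R + s * (a == j)%:R
                 else if b == j then - s * (a == i)%:R + c * (a == j)%:R
                 else (a == b)%:R.

(** What a rotation in the plane (i, j) adds to a diagonal matrix whose entries i
    and j differ by one. *)
Definition givens_shift i j c s : 'M[R]_n :=
  (c * s) *: (delta_mx i j + delta_mx j i) -
  s ^+ 2 *: (delta_mx i i - delta_mx j j).

(** The two rotated basis vectors are [c e_i + s e_j] and [c e_j - s e_i]; the
    difference of their projectors with those on e_i and e_j is [givens_shift] and
    its opposite. *)
Lemma givens_conj_diag i j c s (x : 'rV[R]_n) : i != j -> c ^+ 2 + s ^+ 2 = 1 ->
  givens i j c s *m diag_mx x *m (givens i j c s)^T =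
  diag_mx x + (x 0 i - x 0 j) *: givens_shift i j c s.
Proof.
move=> ij cs1; have ji : j != i by rewrite eq_sym.
rewrite mul_mx_diag; apply/matrixP => a b.
have -> : diag_mx x = \matrix_(a, b) \sum_k x 0 k * (a == k)%:R * (b == k)%:R :> 'M[R]_n.
  apply/matrixP => a' b'; rewrite !mxE (bigD1 a') //= eqxx mulr1 big1 ?addr0.
    by rewrite mulr_natr eq_sym.
  by move=> k ka; rewrite eq_sym (negbTE ka) mulr0 mul0r.
rewrite !mxE.
under eq_bigr do rewrite !mxE.
rewrite (bigD1 i) // (bigD1 j) //= [in RHS](bigD1 i) // [in RHS](bigD1 j) //=.
rewrite (eq_bigr (fun k => x 0 k * (a == k)%:R * (b == k)%:R)); last first.
  by move=> k /andP[ki kj]; rewrite (negbTE ki) (negbTE kj); ring.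
rewrite !eqxx (negbTE ji).
move: (\sum_(k | _) _) => rest; rewrite -!mulnb !natrM.
apply/eqP; rewrite -subr_eq0; apply/eqP.
rewrite (_ : _ - _ = (c ^+ 2 + s ^+ 2 - 1) * (x 0 i * (a == i)%:R * (b == i)%:R +
  x 0 j * (a == j)%:R * (b == j)%:R)); first by rewrite cs1 subrr mul0r.
by ring.
Qed.

(** The case of the identity matrix, which the rotation does not shift. *)
Lemma givens_orthogonal i j c s : i != j -> c ^+ 2 + s ^+ 2 = 1 ->
  givens i j c s *m (givens i j c s)^T = 1%:M.
Proof.
move=> ij cs1; have := givens_conj_diag (const_mx 1) ij cs1.
by rewrite diag_const_mx mulmx1 !mxE subrr scale0r addr0.
Qed.

Lemma trace_delta_mul (T : 'M[R]_n) (i j : 'I_n) : \tr (delta_mx i j *m T) = T j i.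
Proof.
rewrite mxtrace_mulC /mxtrace (bigD1 j) //= big1 ?addr0; last first.
  move=> k kj; rewrite mxE big1 // => l _.
  by rewrite !mxE (negbTE kj) andbF mulr0.
rewrite mxE (bigD1 i) //= big1 ?addr0 => [|l li].
  by rewrite mxE !eqxx mulr1.
by rewrite mxE (negbTE li) mulr0.
Qed.

Lemma trace_givens_shift i j c s (T : 'M[R]_n) :
  \tr (givens_shift i j c s *m T) =
  c * s * (T j i + T i j) - s ^+ 2 * (T i i - T j j).
Proof.
rewrite /givens_shift mulmxBl -!scalemxAl !mulmxDl mulNmx.
by rewrite raddfB /= !mxtraceZ !mxtraceD raddfN /= !trace_delta_mul.
Qed.

(** First-order condition at the angle 0.  The unit circle is parametrized
    rationally by t, and t = e b with e small makes the linear term dominate. *)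
Lemma rotation_stationary (a b : R) :
  (forall c s, c ^+ 2 + s ^+ 2 = 1 -> c * s * (2 * b) - s ^+ 2 * a <= 0) -> b = 0.
Proof.
move=> H; apply/eqP/negPn/negP => b0.
have b2 : 0 < b ^+ 2 by rewrite exprn_even_gt0.
pose e := (1 + b ^+ 2 + `|a|)^-1.
have N0 : 0 < 1 + b ^+ 2 + `|a| by rewrite ltr_pwDl // ltr_pwDl // ltW.
have e0 : 0 < e by rewrite invr_gt0.
have e1 : e <= 1.
  by rewrite invf_le1 // -addrA lerDl addr_ge0 // ltW.
have eN : e * (1 + b ^+ 2 + `|a|) = 1 by rewrite mulVf // gt_eqF.
pose t := e * b; have D0 : 0 < 1 + t ^+ 2 by rewrite ltr_pwDl // sqr_ge0.
have Dn : 1 + t ^+ 2 != 0 by rewrite gt_eqF.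
have /H : ((1 - t ^+ 2) / (1 + t ^+ 2)) ^+ 2 + (2 * t / (1 + t ^+ 2)) ^+ 2 = 1.
  by field.
rewrite (_ : _ - _ = 4 * e / (1 + t ^+ 2) ^+ 2 *
   (b ^+ 2 * (1 - t ^+ 2 - e * a))); last by rewrite /t; field; rewrite -/t.
rewrite leNgt => /negP; apply; apply: mulr_gt0.
  by rewrite divr_gt0 ?exprn_gt0 // mulr_gt0.
apply: mulr_gt0; first by [].
have h1 : e * a <= e * `|a| by rewrite ler_pM2l // ler_norm.
have h2 : t ^+ 2 <= e * b ^+ 2 by rewrite /t exprMn ler_pM2r // expr2 ger_pMl.
rewrite !mulrDr mulr1 in eN; by lra.
Qed.

(** Brockett's variational argument: on the compact orthogonal group, take P that
    maximizes [\tr (N P^T S P)] with N diagonal and with distinct entries.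
    Rotating P in the plane (i, j) cannot increase this trace, which forces the
    entry (i, j) of P^T S P to vanish. *)
Lemma symmetric_spectral (S : 'M[R]_n) : S^T = S ->
  exists P : 'M[R]_n, exists d : 'rV[R]_n,
    P *m P^T = 1%:M /\ S = P *m diag_mx d *m P^T.
Proof.
move=> ST; pose O : set 'rV[R]_(n * n) :=
  [set v | (vec_mx v : 'M[R]_n) *m (vec_mx v)^T = 1%:M].
have cvec i j : continuous (fun v : 'rV[R]_(n * n) => (vec_mx v : 'M[R]_n) i j).
  rewrite (_ : (fun v => _) = fun v : 'rV[R]_(n * n) => v 0 (mxvec_index i j)).
    exact: coord_continuous.
  by apply/funext => v; rewrite mxE.
have clO : closed O.
  rewrite (_ : O = \bigcap_(ij in [set: 'I_n * 'I_n])
    ((fun v => ((vec_mx v : 'M[R]_n) *m (vec_mx v)^T) ij.1 ij.2) @^-1`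
      [set x | x = (1%:M : 'M[R]_n) ij.1 ij.2])).
    apply: closed_bigI => -[i j] _ /=; apply: closed_comp; last exact: closed_eq.
    move=> v _ /=; rewrite (_ : (fun v => _) =
        fun v => \sum_k (vec_mx v : 'M[R]_n) i k * (vec_mx v : 'M[R]_n) j k).
      apply: continuous_big => [|k _ w]; first exact: add_continuous.
      by apply: continuousM; exact: cvec.
    by apply/funext => w; rewrite mxE; apply: eq_bigr => k _; congr (_ * _); rewrite [LHS]mxE.
  apply/seteqP; split=> [v /= Ov [i j] _ /=|v /= Ov]; first by rewrite Ov.
  by apply/matrixP => i j; have := Ov (i, j) I.
have cO : compact O.
  have cube : compact [set v : 'rV[R]_(n * n) | forall k, `[-1, 1]%classic (v ord0 k)].
    apply: (@rV_compact _ _ (fun=> `[(-1 : R), 1]%classic)).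
    by move=> _; exact: segment_compact.
  apply: subclosed_compact clO cube _ => v Ov k; rewrite /= in_itv /= -ler_norml -(ler_pXn2r (n := 2)) ?nnegrE //.
  rewrite expr1n real_normK ?num_real //.
  case/mxvec_indexP: k => i j; rewrite (_ : v _ _ = (vec_mx v : 'M[R]_n) i j); last by rewrite mxE.
  have -> : 1 = \sum_l (vec_mx v : 'M[R]_n) i l ^+ 2.
    have := congr1 (fun M : 'M[R]_n => M i i) Ov; rewrite [RHS]mxE eqxx mulr1n => <-.
    by rewrite mxE; apply: eq_bigr => l _; rewrite expr2; congr (_ * _); rewrite mxE.
  by rewrite (bigD1 j) //= lerDl sumr_ge0 // => l _; rewrite sqr_ge0.
(* The weights 0, 1, ..., n-1 only need to be distinct. *)
pose w : 'rV[R]_n := \row_i (i : nat)%:R.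
pose F (P : 'M[R]_n) := \tr (diag_mx w *m (P^T *m S *m P)).
have cT i k l : continuous (fun v : 'rV[R]_(n * n) =>
    (vec_mx v : 'M[R]_n) k i * S k l * (vec_mx v : 'M[R]_n) l i).
  have cS : continuous (fun v : 'rV[R]_(n * n) => (vec_mx v : 'M[R]_n) k i * S k l).
    by move=> v; apply: continuousM; [exact: cvec|exact: cst_continuous].
  by move=> v; exact: (continuousM (cS v) (cvec l i v)).
have cD i : continuous (fun v : 'rV[R]_(n * n) => \sum_k \sum_l
    (vec_mx v : 'M[R]_n) k i * S k l * (vec_mx v : 'M[R]_n) l i).
  apply: continuous_big => [|k _]; first exact: add_continuous.
  by apply: continuous_big => [|l _]; [exact: add_continuous|exact: cT].
have cF : continuous (fun v : 'rV[R]_(n * n) => F (vec_mx v)).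
  rewrite (_ : (fun v => _) = fun v : 'rV[R]_(n * n) => \sum_i w 0 i *
    (\sum_k \sum_l (vec_mx v : 'M[R]_n) k i * S k l * (vec_mx v : 'M[R]_n) l i)).
    apply: continuous_big => [|i _ v]; first exact: add_continuous.
    by exact: (continuousM (@cst_continuous _ _ (w 0 i) v) (cD i v)).
  apply/funext => v; rewrite /F /mxtrace; apply: eq_bigr => i _.
  rewrite mul_diag_mx !mxE; congr (_ * _); rewrite exchange_big; apply: eq_bigr => l _.
  rewrite mxE mulr_suml; apply: eq_bigr => k _.
  by rewrite mxE.
have O0 : O !=set0.
  by exists (mxvec 1%:M); rewrite /O /= mxvecK trmx1 mulmx1.
have [v] := compact_EVT_max O0 cO (continuous_subspaceT cF).
rewrite inE /O /=; move: (vec_mx v) => P PP vmax.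
have {vmax}Pmax Q : Q *m Q^T = 1%:M -> F Q <= F P.
  by move=> QQ; have := vmax (mxvec Q); rewrite inE /O /= mxvecK; apply.
have [T ET] : exists T, T = P^T *m S *m P by exists (P^T *m S *m P).
have TT : T^T = T by rewrite ET !trmx_mul trmxK ST mulmxA.
exists P, (\row_i T i i); split=> //.
suff <- : T = diag_mx (\row_i T i i).
  by rewrite ET !mulmxA PP mul1mx -!mulmxA PP mulmx1.
apply/matrixP => i j; rewrite !mxE.
have [->|ij] := eqVneq i j; first by rewrite mulr1n.
rewrite mulr0n.
wlog ltij : i j ij / (j < i)%N.
  move=> H; have := ij; rewrite -val_eqE neq_ltn => /orP[|] lt; last exact: H.
  by rewrite -TT mxE; apply: H => //; rewrite eq_sym.
apply: (rotation_stationary (a := T i i - T j j)) => c s cs1.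
have := Pmax (P *m givens i j c s).
rewrite trmx_mul mulmxA -[P *m _ *m _]mulmxA givens_orthogonal // mulmx1 => /(_ PP).
have -> : F (P *m givens i j c s) =
    \tr (givens i j c s *m diag_mx w *m (givens i j c s)^T *m T).
  by rewrite /F trmx_mul ET !mulmxA mxtrace_mulC !mulmxA.
rewrite givens_conj_diag // mulmxDl mxtraceD -scalemxAl mxtraceZ trace_givens_shift.
rewrite /F -ET gerDl -{1}TT !mxE pmulr_rle0 ?subr_gt0 ?ltr_nat //.
by rewrite [2 * _]mulr_natl mulr2n.
Qed.

End Givens.

(** * The cone of positive definite matrices *)

Lemma open_of_balls (R : realType) (V : normedModType R) (U : set V) :
  (forall x, U x -> exists2 r, 0 < r & forall y, `|x - y| < r -> U y) -> open U.
Proof.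
move=> H; rewrite openE => x /H[r r0 rU]; apply/nbhs_ballP; exists r => //= y.
by rewrite -ball_normE; exact: rU.
Qed.

Section SPDfacts.
Variables (R : realType) (n : nat).
Local Notation sym := (sym R n).
Local Notation SPD := (@SPD R n).
Implicit Types (P : 'M[R]_n) (d x : 'rV[R]_n) (S : sym).

Definition sqnorm x : R := \sum_i x 0 i ^+ 2.

Lemma sqnormE x : sqnorm x = (x *m x^T) 0 0.
Proof. by rewrite mxE; apply: eq_bigr => i _; rewrite mxE expr2. Qed.

Lemma sqnorm_gt0 x : x != 0 -> 0 < sqnorm x.
Proof.
rewrite lt0r sumr_ge0 ?andbT => [x0|i _]; last exact: sqr_ge0.
apply: contra x0; rewrite psumr_eq0 => [/allP H|i _]; last exact: sqr_ge0.
apply/eqP/rowP => i; have := H i; rewrite mem_index_enum mxE => /(_ isT).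
by rewrite sqrf_eq0 => /eqP.
Qed.

Lemma sqnorm_orthogonal P x : P *m P^T = 1%:M -> sqnorm (x *m P) = sqnorm x.
Proof. by move=> PP; rewrite !sqnormE trmx_mul mulmxA -(mulmxA x) PP mulmx1. Qed.

Lemma quadratic_form_diag P d x :
  (x *m (P *m diag_mx d *m P^T) *m x^T) 0 0 = \sum_i d 0 i * (x *m P) 0 i ^+ 2.
Proof.
rewrite !mulmxA -(mulmxA _ P^T) -trmx_mul mul_mx_diag mxE.
apply: eq_bigr => i _; rewrite mxE [in X in _ * X]mxE.
by rewrite expr2 mulrCA mulrA.
Qed.

Lemma SPD_spectral_gt0 P d S : SPD S -> P *m P^T = 1%:M ->
  symval S = P *m diag_mx d *m P^T -> forall i, 0 < d 0 i.
Proof.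
move=> HS PP SE i; have PtP : P^T *m P = 1%:M by exact: mulmx1C.
pose x : 'rV[R]_n := delta_mx 0 i *m P^T.
have xP : x *m P = delta_mx 0 i by rewrite /x -mulmxA PtP mulmx1.
have x0 : x != 0.
  apply/eqP => x0; move: xP; rewrite x0 mul0mx => /rowP/(_ i)/eqP.
  by rewrite !mxE !eqxx eq_sym oner_eq0.
have := HS x x0; rewrite SE quadratic_form_diag xP (bigD1 i) //= big1 ?addr0.
  by rewrite mxE !eqxx expr1n mulr1.
by move=> k ki; rewrite mxE (negbTE ki) andbF expr0n mulr0.
Qed.

Lemma SPD_spectralP S : SPD S -> exists P, exists d,
  [/\ P *m P^T = 1%:M, symval S = P *m diag_mx d *m P^T & forall i, 0 < d 0 i].
Proof.
move=> HS; have [P [d [PP SE]]] := symmetric_spectral (symvalT S).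
by exists P, d; split=> //; exact: (SPD_spectral_gt0 HS PP SE).
Qed.

(** A uniform lower bound is the smallest eigenvalue; the minimum is taken together
    with 1 so that it is defined for the empty matrix as well. *)
Lemma SPD_coercive S : SPD S ->
  exists2 e, 0 < e & forall x, e * sqnorm x <= (x *m symval S *m x^T) 0 0.
Proof.
move=> /SPD_spectralP[P [d [PP SE d0]]].
exists (\big[Order.min/1]_i d 0 i).
  by elim/big_ind : _ => // a b a0 b0; rewrite lt_min a0.
move=> x; rewrite SE quadratic_form_diag -(sqnorm_orthogonal x PP) mulr_sumr.
apply: ler_sum => i _; rewrite ler_wpM2r ?sqr_ge0 //.
by rewrite bigmin_le_cond.
Qed.

Lemma quadratic_form_le (E : 'M[R]_n) (r : R) x : (forall i j, `|E i j| <= r) ->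
  (x *m E *m x^T) 0 0 <= n%:R * r * sqnorm x.
Proof.
move=> Er.
have -> : (x *m E *m x^T) 0 0 = \sum_i \sum_j x 0 j * E j i * x 0 i.
  by rewrite mxE; apply: eq_bigr => i _; rewrite !mxE mulr_suml.
(* From the squares of a + c and a - c, weighted by r - e and r + e. *)
have b a c e : `|e| <= r -> a * e * c <= r * 2^-1 * (a ^+ 2 + c ^+ 2).
  move=> er; have r0 : 0 <= r by exact: le_trans er.
  have h1 : 0 <= (r - e) * (a + c) ^+ 2 by rewrite mulr_ge0 ?sqr_ge0 // subr_ge0 (le_trans (ler_norm _)).
  have h2 : 0 <= (r + e) * (a - c) ^+ 2.
    by rewrite mulr_ge0 ?sqr_ge0 // -lerBlDl sub0r lerNl (le_trans _ er) // -normrN ler_norm.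
  nra.
apply: (@le_trans _ _ (\sum_i \sum_j r * 2^-1 * (x 0 j ^+ 2 + x 0 i ^+ 2))).
  by apply: ler_sum => i _; apply: ler_sum => j _; exact: b.
under eq_bigr do rewrite -mulr_sumr big_split /= sumr_const card_ord.
rewrite -mulr_sumr big_split /= sumr_const card_ord sumrMnl -/(sqnorm x).
rewrite -mulrnDl -[_ *+ n]mulr_natl le_eqVlt; apply/orP; left; apply/eqP.
by field.
Qed.

(** A perturbation with entries smaller than e / (n + 1) changes the quadratic form
    by less than the coercivity bound e. *)
Lemma open_SPD : open SPD.
Proof.
apply: open_of_balls => S /SPD_coercive[e e0 Se].
exists (e / n.+1%:R) => [|T ST x x0]; first by rewrite divr_gt0.
have q : (x *m (symval S - symval T) *m x^T) 0 0 <= n%:R * (e / n.+1%:R) * sqnorm x.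
  apply: quadratic_form_le => i j; have := sym_entry_le i j (S - T).
  by rewrite /sym_entry symvalB => /le_trans; apply; exact: ltW.
have -> : (x *m symval T *m x^T) 0 0 =
    (x *m symval S *m x^T) 0 0 - (x *m (symval S - symval T) *m x^T) 0 0.
  by rewrite mulmxBr mulmxBl !mxE opprB addrC subrK.
rewrite subr_gt0 (le_lt_trans q) // (lt_le_trans _ (Se x)) // ltr_pM2r ?sqnorm_gt0 //.
by rewrite mulrCA gtr_pMr // ltr_pdivrMr // mul1r ltr_nat.
Qed.

Lemma SPD1 : SPD (sym1 R n).
Proof. by move=> x x0 /=; rewrite mulmx1 -sqnormE sqnorm_gt0. Qed.

Lemma SPD_segment S T t : SPD S -> SPD T -> 0 <= t <= 1 -> SPD (S + t *: (T - S)).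
Proof.
move=> HS HT /andP[t0 t1] x x0.
have -> : symval (S + t *: (T - S)) = (1 - t) *: symval S + t *: symval T.
  by rewrite symvalD symvalZ symvalB; apply/matrixP => i j; rewrite !mxE; ring.
rewrite mulmxDr mulmxDl -!scalemxAr -!scalemxAl mxE [X in X + _]mxE [X in _ + X]mxE.
have := HS x x0; have := HT x x0; set a := (_ *m _ *m _) 0 0; set b := (_ *m _) 0 0.
move=> a0 b0; have [->|tn0] := eqVneq t 0; first by rewrite subr0 mul1r mul0r addr0.
rewrite ltr_wpDl // ?mulr_ge0 ?subr_ge0 // ?ltW //.
by rewrite mulr_gt0 // lt0r tn0.
Qed.

End SPDfacts.

(** * Parallel transport of a pulled back Euclidean metric *)

Lemma is_derive0_cst (R : realType) (W : normedModType R) (F : R -> W)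
    (L : {linear W -> R}) :
  continuous L -> (forall t : R, 0 <= t <= 1 -> is_derive t 1 F 0) -> L (F 1) = L (F 0).
Proof.
move=> cL FD.
have [|t tI] := @MVT_from0 R (L \o F) (fun=> 0) 1 ler01.
  move=> t /FD FDt; have dL : differentiable L (F t) by exact: linear_differentiable.
  by have LD := is_derive_comp FDt dL; rewrite linear0 in LD.
by rewrite mul0r => /eqP; rewrite subr_eq0 => /eqP.
Qed.

Lemma smooth_line (R : realType) (V : normedModType R) (x h : V) :
  smooth_on setT (fun t : R => x + t *: h).
Proof.
move=> k; apply: (@Ck_affine _ _ _ k setT _ (fun v : R => v *: h)); first exact: openT.
  move=> t; apply/derivable1_diffP; exact: (@ex_derive _ _ _ _ _ _ _ (is_derive_line x h t)).
move=> t v; have lD := is_derive_line x h t.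
rewrite deriveE; last by apply/derivable1_diffP; exact: ex_derive.
rewrite -[v in 'd _ _ v]mulr1 linearZ /= -deriveE.
  by rewrite derive_val.
by apply/derivable1_diffP; exact: ex_derive.
Qed.

Section SymInner.
Variables (R : realType) (n : nat).
Local Notation sym := (sym R n).

Definition sym_inner (A B : sym) : R := \tr (symval A *m symval B).

Lemma sym_innerE (A B : sym) :
  sym_inner A B = \sum_ij sym_entry ij.1 ij.2 A * sym_entry ij.1 ij.2 B.
Proof.
rewrite -(pair_bigA _ (fun i j => sym_entry i j A * sym_entry i j B)) /=.
apply: eq_bigr => i _; rewrite mxE; apply: eq_bigr => j _.
by rewrite /sym_entry [symval B j i]symvalC.
Qed.

Lemma sym_innerC (A B : sym) : sym_inner A B = sym_inner B A.
Proof. exact: mxtrace_mulC. Qed.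

Lemma sym_innerBl (A B C : sym) : sym_inner (A - B) C = sym_inner A C - sym_inner B C.
Proof. by rewrite /sym_inner symvalB mulmxBl raddfB. Qed.

Lemma sym_inner_eq0 (A : sym) : sym_inner A A = 0 -> A = 0.
Proof.
rewrite sym_innerE => /eqP; rewrite psumr_eq0 => [/allP H|i _]; last first.
  by rewrite -expr2 sqr_ge0.
apply: sym_entryP => i j; have := H (i, j); rewrite mem_index_enum => /(_ isT) /=.
by rewrite mulf_eq0 orbb => /eqP ->; rewrite linear0.
Qed.

Lemma sym_coordinates (A : sym) :
  A = \sum_(ij : 'I_n * 'I_n)
        sym_entry ij.1 ij.2 A *: sym_of (delta_mx ij.1 ij.2).
Proof.
by rewrite -(pair_bigA _ (fun i j => sym_entry i j A *: sym_of (delta_mx i j)))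
           -sym_expand.
Qed.
End SymInner.

(** Uniqueness of the Levi-Civita connection, at one point.  The defect
    [E A B C = b (G A B - D A B) (f C)] is symmetric in A, B and antisymmetric in
    B, C; such a tensor vanishes, as six alternating exchanges change its sign and
    bring back the arguments. *)
Lemma koszul_uniqueness (R : realDomainType) (V W : zmodType) (b : W -> W -> R)
    (f : V -> W) (G D : V -> V -> W) :
  (forall x y, b x y = b y x) -> (forall x y z, b (x - y) z = b x z - b y z) ->
  (forall x, b x x = 0 -> x = 0) -> (forall y, exists x, f x = y) ->
  (forall X Y, G X Y = G Y X) -> (forall X Y, D X Y = D Y X) ->
  (forall X Y Z, b (D X Y) (f Z) + b (f Y) (D X Z) =
                 b (G X Y) (f Z) + b (f Y) (G X Z)) ->
  forall X Y, G X Y = D X Y.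
Proof.
move=> bC bB b0 fsurj GC DC H X Y; pose E A B C := b (G A B - D A B) (f C).
have E1 A B C : E A B C = E B A C by rewrite /E GC DC.
have E2 A B C : E A B C = - E A C B.
  have := H A B C; rewrite /E !bB [b (f B) _]bC [b (f B) (G _ _)]bC.
  move: (b _ _) (b _ _) (b _ _) (b _ _) => p q r s; lra.
have E0 C : E X Y C = 0.
  suff : E X Y C = - E X Y C by lra.
  by rewrite {1}E2 {1}E1 {1}E2 opprK {1}E1 {1}E2 {1}E1.
have [Z fZ] := fsurj (G X Y - D X Y).
by apply/eqP; rewrite -subr_eq0; apply/eqP/b0; rewrite -{2}fZ; exact: E0.
Qed.

Section FlatPullback.
Variables (R : realType) (n : nat).
Local Notation sym := (sym R n).
Local Notation SPD := (@SPD R n).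
Variables (u w : sym -> sym).
Hypotheses (su : smooth_on SPD u) (oV : open (u @` SPD))
  (sw : smooth_on (u @` SPD) w) (uK : forall S, SPD S -> w (u S) = S).
Implicit Types (S T X Y Z A : sym).

Local Notation g := (deformed_euclidean u).

Lemma pullbackE S X Y : g S X Y = sym_inner ('d u S X) ('d u S Y).
Proof. by []. Qed.

Lemma pullback_diff S : SPD S -> differentiable u S.
Proof. by move=> HS; have [+ _] := su 1; exact. Qed.

Lemma pullback_diff_inv S : SPD S -> differentiable w (u S).
Proof. by move=> HS; have [+ _] := sw 1; apply; exists S. Qed.

Lemma pullback_diffD S X : SPD S -> differentiable ('D_X u) S.
Proof. by move=> HS; have [_ /(_ X)[+ _]] := su 2; exact. Qed.

Lemma pullback_dK S X : SPD S -> 'd w (u S) ('d u S X) = X.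
Proof.
move=> HS; apply: (derivative_of_inverse (@open_SPD R n) HS uK).
  exact: pullback_diff.
exact: pullback_diff_inv.
Qed.

(** Here the roles of u and w are exchanged; this is where the image of u has to be
    open. *)
Lemma pullback_Kd S A : SPD S -> 'd u S ('d w (u S) A) = A.
Proof.
move=> HS.
have wK B : (u @` SPD) B -> u (w B) = B by case=> T HT <-; rewrite uK.
have uS : (u @` SPD) (u S) by exists S.
have := derivative_of_inverse oV uS wK (pullback_diff_inv HS).
by rewrite uK // => /(_ (pullback_diff HS)).
Qed.

Lemma derive_pullback S X Y Z : SPD S ->
  'D_X (fun T => g T Y Z) S =
  sym_inner ('D_X ('D_Y u) S) ('d u S Z) + sym_inner ('d u S Y) ('D_X ('D_Z u) S).
Proof.
move=> HS.
pose G T := \sum_(ij : 'I_n * 'I_n)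
   ((sym_entry ij.1 ij.2 \o 'D_Y u) * (sym_entry ij.1 ij.2 \o 'D_Z u)) T.
have gG T : SPD T -> g T Y Z = G T.
  move=> HT; rewrite pullbackE sym_innerE; apply: eq_bigr => ij _.
  by rewrite -!deriveE //; exact: pullback_diff.
rewrite (near_eq_derive X (near_eq_on (@open_SPD R n) HS gG)).
have eD ij V : is_derive S X (sym_entry ij.1 ij.2 \o 'D_V u)
    (sym_entry ij.1 ij.2 ('D_X ('D_V u) S)).
  have dV := pullback_diffD V HS.
  have cE : continuous (@sym_entry R n ij.1 ij.2) by exact: continuous_sym_entry.
  apply: DeriveDef; last exact: derive_linear_comp.
  apply: diff_derivable; apply: differentiable_comp => //.
  exact: linear_differentiable.
have GD := is_derive_bigsum (fun ij => is_deriveM (eD ij Y) (eD ij Z)).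
rewrite (@derive_val _ _ _ _ _ _ _ GD) !sym_innerE -big_split /=.
apply: eq_bigr => ij _.
rewrite [in LHS]/GRing.scale /= addrC; congr (_ + _).
  by rewrite -(deriveE _ (pullback_diff HS)).
by rewrite -(deriveE _ (pullback_diff HS)) mulrC.
Qed.

Lemma derive2_comm S X Y : SPD S -> 'D_X ('D_Y u) S = 'D_Y ('D_X u) S.
Proof.
move=> HS; apply: sym_entryP => i j.
by apply: (derive_linear_comm _ _ _ (@open_SPD R n) HS (su 2)); exact: continuous_sym_entry.
Qed.

(** The connection for which the constant fields of the target are parallel. *)
Definition pullback_connection S X Y : sym := 'd w (u S) ('D_X ('D_Y u) S).

(** Torsion-freeness is the symmetry of second derivatives; compatibility is the
    product rule. *)
Lemma pullback_levi_civita : levi_civita g pullback_connection.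
Proof.
move=> S HS.
have linX Y a X1 X2 : 'D_(a *: X1 + X2) ('D_Y u) S =
   a *: 'D_X1 ('D_Y u) S + 'D_X2 ('D_Y u) S.
  by rewrite !(deriveE _ (pullback_diffD Y HS)) linearP.
have C X Y : pullback_connection S X Y = pullback_connection S Y X.
  exact: (congr1 ('d w (u S)) (derive2_comm X Y HS)).
have L Y a X1 X2 : pullback_connection S (a *: X1 + X2) Y =
    a *: pullback_connection S X1 Y + pullback_connection S X2 Y.
  by rewrite /pullback_connection linX linearP.
split; [split=> [Y a X1 X2|X a Y1 Y2] | exact: C | ].
- exact: L.
- by rewrite /= !(C X); exact: L.
- move=> X Y Z; rewrite (derive_pullback X Y Z HS).
  rewrite !pullbackE.
  rewrite -(pullback_Kd ('D_X ('D_Y u) S) HS).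
  by rewrite -(pullback_Kd ('D_X ('D_Z u) S) HS).
Qed.

(** A parallel field comes with a Levi-Civita connection of unspecified form; this
    pins it down at the points of SPD(n). *)
Lemma levi_civita_pullback G S X Y : levi_civita g G -> SPD S ->
  'd u S (G S X Y) = 'D_X ('D_Y u) S.
Proof.
move=> LG HS; have [_ Gsym Gcomp] := LG S HS.
apply: (@koszul_uniqueness R sym sym (@sym_inner R n) ('d u S)
  (fun X Y => 'd u S (G S X Y)) (fun X Y => 'D_X ('D_Y u) S)).
- exact: sym_innerC.
- exact: sym_innerBl.
- exact: sym_inner_eq0.
- by move=> A; exists ('d w (u S) A); exact: (pullback_Kd A HS).
- by move=> A B; rewrite Gsym.
- by move=> A B; exact: derive2_comm.
- by move=> A B C; rewrite -(derive_pullback A B C HS) Gcomp.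
Qed.

Lemma is_derive_pullback_apply (c X : R -> sym) t c' X' : SPD (c t) ->
  is_derive t 1 c c' -> is_derive t 1 X X' ->
  is_derive t 1 (fun s => 'd u (c s) (X s))
    ('d u (c t) X' + 'D_c' ('D_(X t) u) (c t)).
Proof.
apply: (@is_derive_diff_apply _ _ _ SPD ('I_n * 'I_n)%type
   (fun ij => sym_entry ij.1 ij.2) (fun ij => sym_of (delta_mx ij.1 ij.2))).
- by move=> ij; exact: continuous_sym_entry.
- exact: sym_coordinates.
- exact: open_SPD.
- exact: su.
Qed.

(** Along any curve the field [dw_{u(c)} A], with A = du_S X constant, is parallel:
    differentiating [du_c (dw_{u(c)} A) = A] gives the transport equation. *)
Lemma pullback_is_transport S T X : is_transport g S T X ('d w (u T) ('d u S X)).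
Proof.
move=> c [sc cSPD c0 c1]; pose A := 'd u S X.
exists (fun t => 'D_A w (u (c t))); last first.
  have HS : SPD S by rewrite -c0; apply: cSPD; rewrite lexx ler01.
  have HT : SPD T by rewrite -c1; apply: cSPD; rewrite lexx ler01.
  split; first by rewrite c0 (deriveE _ (pullback_diff_inv HS)); exact: pullback_dK.
  by rewrite c1 (deriveE _ (pullback_diff_inv HT)).
exists pullback_connection; first exact: pullback_levi_civita.
move=> t tI; have Hc := cSPD t tI.
have cD : is_derive t 1 c ('D_1 c t).
  by apply: derivableP; apply: diff_derivable; have [+ _] := sc 1; exact.
set X1 := fun s => _.
have X1D : is_derive t 1 X1 ('d ('D_A w) (u (c t)) ('d u (c t) ('D_1 c t))).
  apply: (is_derive_comp (f := 'D_A w)).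
    by apply: (is_derive_comp (f := u)) => //; exact: pullback_diff.
  by have [_ /(_ A)[+ _]] := sw 2; apply; exists (c t).
apply: (is_derive_eq X1D); set X' := 'd _ _ _.
have PD := is_derive_pullback_apply Hc cD X1D.
have /near_eq_is_derive/(_ PD) : \forall s \near t, 'd u (c s) (X1 s) = A.
  apply: filterS (near_curve (@open_SPD R n) Hc cD) => s Hs.
  by rewrite /X1 (deriveE _ (pullback_diff_inv Hs)); exact: pullback_Kd.
move/(@derive_val _ _ _ _ _ _ _); rewrite derive_cst => /esym/eqP.
rewrite addr_eq0 => /eqP E.
exact: (etrans (esym (pullback_dK X' Hc))
  (etrans (congr1 ('d w (u (c t))) E) (linearN _ _))).
Qed.

(** One curve is enough for uniqueness, and SPD(n) contains the segment from S to
    T.  Along it [du_c X] has zero derivative for every parallel field X. *)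
Lemma is_transport_pullback S T X Y : SPD S -> SPD T ->
  is_transport g S T X Y -> Y = 'd w (u T) ('d u S X).
Proof.
move=> HS HT tXY; pose c (t : R) := S + t *: (T - S).
have cS : smooth_curve S T c.
  split; first exact: smooth_line.
  - by move=> t; exact: SPD_segment.
  - by rewrite /c scale0r addr0.
  - by rewrite /c scale1r addrC subrK.
have [Xc [G LG XD] [<- <-]] := tXY c cS.
have [_ cSPD c0 c1] := cS.
suff E : 'd u T (Xc 1) = 'd u S (Xc 0).
  exact: (etrans (esym (pullback_dK (Xc 1) HT)) (congr1 ('d w (u T)) E)).
apply: sym_entryP => i j.
suff K : sym_entry i j ('d u (c 1) (Xc 1)) = sym_entry i j ('d u (c 0) (Xc 0)).
  by rewrite c0 c1 in K.
apply: (is_derive0_cst (F := fun t => 'd u (c t) (Xc t))).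
  exact: continuous_sym_entry.
move=> t tI; have Hc := cSPD t tI.
have cD : is_derive t 1 c ('D_1 c t).
  by apply: derivableP; exact: (@ex_derive _ _ _ _ _ _ _ (is_derive_line _ _ t)).
apply: is_derive_eq (is_derive_pullback_apply Hc cD (XD t tI)) _.
by rewrite linearN /= (levi_civita_pullback _ _ LG Hc) addNr.
Qed.

Lemma transport_pullback S T X : SPD S -> SPD T ->
  transport g S T X = 'd w (u T) ('d u S X).
Proof.
move=> HS HT; apply: xget_unique; first exact: pullback_is_transport.
by move=> Y; exact: is_transport_pullback.
Qed.

End FlatPullback.

(** * The differential of a univariate map *)

Lemma derive_unique_near (R : realType) (W : normedModType R) (F G : R -> W) (t : R)
    (a b : W) :
  (\forall s \near t, F s = G s) -> is_derive t 1 F a -> is_derive t 1 G b -> a = b.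
Proof. by move=> FG [_ <-] [_ <-]; exact: near_eq_derive. Qed.

Lemma is_deriveZl_cst (R : realType) (W : normedModType R) (a : R -> R) (t da : R)
    (K : W) : is_derive t 1 a da -> is_derive t 1 (fun s => a s *: K) (da *: K).
Proof.
move=> aD; have := is_deriveZr aD (is_derive_cst K t 1).
by rewrite scaler0 addr0.
Qed.

(** The derivative at the angle 0 of the curve produced by a rotation through
    [givens_shift]: only the off-diagonal part K1 is seen at first order. *)
Lemma is_derive_rotation (R : realType) (W : normedModType R) (K1 K2 x : W) (k : R) :
  is_derive (0 : R) 1 (fun t => x + k *: ((cos t * sin t) *: K1 - sin t ^+ 2 *: K2))
    (k *: K1).
Proof.
have sD : is_derive (0 : R) 1 (@sin R) 1.
  by apply: is_derive_eq; exact: cos0.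
have cD : is_derive (0 : R) 1 (@cos R) 0.
  by apply: is_derive_eq; rewrite sin0 oppr0.
have h1 : is_derive (0 : R) 1 (fun t => cos t * sin t) 1.
  by apply: is_derive_eq (is_deriveM cD sD) _; rewrite cos0 sin0 scaler0 addr0 scale1r.
have h2 : is_derive (0 : R) 1 (fun t => sin t ^+ 2) 0.
  by apply: is_derive_eq (is_deriveX 2 sD) _; rewrite sin0 expr1 mulr0 scale0r.
have := is_deriveD (is_derive_cst x (0 : R) 1)
  (is_deriveZ k (is_deriveB (is_deriveZl_cst K1 h1) (is_deriveZl_cst K2 h2))).
by rewrite add0r scale0r subr0 scale1r.
Qed.

Section ConjSym.
Variables (R : realType) (n : nat).
Local Notation sym := (sym R n).
Implicit Types (P M : 'M[R]_n) (d : 'rV[R]_n).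

(** A matrix M read in the basis formed by the columns of P, as an element of
    [sym]. *)
Definition conj_sym P M : sym := sym_of (P *m M *m P^T).

Fact conj_sym_linear P : linear (conj_sym P).
Proof.
by move=> a M N; rewrite /conj_sym mulmxDr mulmxDl -scalemxAr -scalemxAl linearP.
Qed.

HB.instance Definition _ P := GRing.isLinear.Build R 'M[R]_n sym *:%R (conj_sym P)
  (conj_sym_linear P).

Lemma conj_symE P M : M^T = M -> symval (conj_sym P M) = P *m M *m P^T.
Proof. by move=> MT; rewrite sym_ofK // !trmx_mul trmxK MT mulmxA. Qed.

Lemma conj_symT P M : conj_sym P M^T = conj_sym P M.
Proof.
apply: symval_inj; rewrite /conj_sym /=; congr (_ *: _).
by rewrite !trmx_mul !trmxK !mulmxA addrC.
Qed.

Lemma conj_symM P Q M : conj_sym (P *m Q) M = conj_sym P (Q *m M *m Q^T).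
Proof. by rewrite /conj_sym trmx_mul !mulmxA. Qed.

(** The symmetric part of an elementary matrix, without the factor 1/2; the maps on
    [sym] are computed on these generators. *)
Lemma conj_sym_delta P i j :
  conj_sym P (delta_mx i j + delta_mx j i) = 2 *: conj_sym P (delta_mx i j).
Proof.
by rewrite linearD /= -[in X in _ + X]conj_symT trmx_delta scaler_nat mulr2n.
Qed.

Lemma SPD_conj_diag P d : P *m P^T = 1%:M -> (forall i, 0 < d 0 i) ->
  SPD (conj_sym P (diag_mx d)).
Proof.
move=> PP d0 x x0; rewrite conj_symE ?tr_diag_mx // quadratic_form_diag.
have y0 : x *m P != 0.
  by apply: contra_neq x0 => xP; rewrite -[x]mulmx1 -PP mulmxA xP mul0mx.
rewrite lt0r sumr_ge0 ?andbT => [|i _]; last by rewrite mulr_ge0 ?sqr_ge0 // ltW.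
apply: contra y0; rewrite psumr_eq0 => [/allP H|i _]; last first.
  by rewrite mulr_ge0 ?sqr_ge0 // ltW.
apply/eqP/rowP => i; have := H i; rewrite mem_index_enum => /(_ isT).
by rewrite mulf_eq0 gt_eqF //= sqrf_eq0 mxE => /eqP ->; rewrite mxE.
Qed.

End ConjSym.

Lemma derive_unique (R : realType) (W : normedModType R) (F G : R -> W) (t : R)
    (a b : W) : F =1 G -> is_derive t 1 F a -> is_derive t 1 G b -> a = b.
Proof. by move=> /funext -> [_ <-] [_ <-]. Qed.

Lemma diag_mx_delta (R : realType) n (i : 'I_n) :
  diag_mx (delta_mx 0 i) = delta_mx i i :> 'M[R]_n.
Proof.
apply/matrixP => a b; rewrite !mxE eqxx /=.
have [->|_] := eqVneq a i; last by rewrite mul0rn.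
by rewrite eq_sym; case: eqP.
Qed.

Section UnivariateDiff.
Variables (R : realType) (n : nat).
Local Notation sym := (sym R n).
Variables (u : sym -> sym) (f : R -> R).
Hypotheses (uf : univariate u f)
  (du : forall S : sym, SPD S -> differentiable u S)
  (df : forall x : R, 0 < x -> differentiable f x).
Implicit Types (P M : 'M[R]_n) (d : 'rV[R]_n).

Lemma univariate_conj_diag P d : P *m P^T = 1%:M -> (forall i, 0 < d 0 i) ->
  u (conj_sym P (diag_mx d)) = conj_sym P (diag_mx (map_mx f d)).
Proof.
move=> PP d0; apply: symval_inj; rewrite conj_symE ?tr_diag_mx //.
by apply: uf => //; rewrite conj_symE ?tr_diag_mx.
Qed.

(** Moving one eigenvalue keeps the eigenbasis, so u moves along a line as f does. *)
Lemma diff_univariate_diag P d i : P *m P^T = 1%:M -> (forall i, 0 < d 0 i) ->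
  'd u (conj_sym P (diag_mx d)) (conj_sym P (delta_mx i i)) =
  'D_1 f (d 0 i) *: conj_sym P (delta_mx i i).
Proof.
move=> PP d0; pose x := conj_sym P (diag_mx d); pose K := conj_sym P (delta_mx i i).
have dd (g : 'rV[R]_n) t :
    diag_mx (g + t *: delta_mx 0 i) = diag_mx g + t *: delta_mx i i :> 'M[R]_n.
  by rewrite linearD linearZ /= diag_mx_delta.
have ud : differentiable u (x + 0 *: K).
  by rewrite scale0r addr0; apply: du; exact: SPD_conj_diag.
have cD := is_derive_comp (is_derive_line x K 0) ud.
have fd : differentiable f (d 0 i + 0 *: 1).
  by rewrite scale0r addr0; exact: df.
have aD : is_derive (0 : R) 1 (fun t => f (d 0 i + t *: 1) - f (d 0 i))
    ('D_1 f (d 0 i + 0 *: 1)).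
  have := is_deriveB (is_derive_along fd) (is_derive_cst (f (d 0 i)) (0 : R) (1 : R)).
  by rewrite subr0.
have FD := is_deriveD (is_derive_cst (conj_sym P (diag_mx (map_mx f d))) (0 : R) (1 : R))
  (is_deriveZl_cst K aD).
rewrite !scale0r !addr0 add0r in cD FD.
apply: (derive_unique_near _ cD FD).
have : \forall t \near (0 : R), 0 < d 0 i + t *: 1.
  apply: (near_curve (@open_gt R 0) _ (is_derive_line (d 0 i) 1 0)).
  by rewrite /= scale0r addr0.
apply: filterS => t t0 /=.
have d1 k : 0 < (d + t *: delta_mx 0 i) 0 k.
  rewrite !mxE eqxx /=; have [->|ki] := eqVneq k i; last by rewrite mulr0 addr0.
  by [].
rewrite /x /K -linearZ -linearD /= -dd univariate_conj_diag //.
rewrite [in RHS]fctE /= /cst /K -linearZ -linearD /= -dd; congr (conj_sym P (diag_mx _)).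
apply/rowP => k; rewrite !mxE eqxx /=.
have [->|ki] := eqVneq k i; first by rewrite !mulr1 [RHS]addrC subrK [t *: 1]mulr1.
by rewrite !mulr0 !addr0.
Qed.

Lemma conj_diag_givens P d i j c s : i != j -> c ^+ 2 + s ^+ 2 = 1 ->
  conj_sym (P *m givens i j c s) (diag_mx d) =
  conj_sym P (diag_mx d) + (d 0 i - d 0 j) *: conj_sym P (givens_shift i j c s).
Proof. by move=> ij cs1; rewrite conj_symM givens_conj_diag // linearD linearZ. Qed.

Lemma givens_mul_orthogonal P i j c s : i != j -> c ^+ 2 + s ^+ 2 = 1 ->
  P *m P^T = 1%:M ->
  (P *m givens i j c s) *m (P *m givens i j c s)^T = 1%:M.
Proof.
move=> ij cs1 PP.
by rewrite trmx_mul mulmxA -[P *m _ *m _]mulmxA givens_orthogonal // mulmx1.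
Qed.

Lemma conj_givens_shift P i j c s : conj_sym P (givens_shift i j c s) =
  (c * s) *: conj_sym P (delta_mx i j + delta_mx j i) -
  s ^+ 2 *: conj_sym P (delta_mx i i - delta_mx j j).
Proof. by rewrite /givens_shift linearB !linearZ. Qed.

(** Rotating the eigenbasis in the plane (i, j) shifts S by a multiple d_i - d_j of
    [givens_shift], and u(S) by the multiple f(d_i) - f(d_j) of the same matrix.
    Differentiate at the angle 0. *)
Lemma diff_univariate_rotation P d i j : P *m P^T = 1%:M ->
  (forall i, 0 < d 0 i) -> i != j ->
  (d 0 i - d 0 j) *: 'd u (conj_sym P (diag_mx d)) (conj_sym P (delta_mx i j + delta_mx j i)) =
  (f (d 0 i) - f (d 0 j)) *: conj_sym P (delta_mx i j + delta_mx j i).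
Proof.
move=> PP d0 ij; set K1 := conj_sym P (_ + _).
pose K2 := conj_sym P (delta_mx i i - delta_mx j j).
pose x := conj_sym P (diag_mx d); pose y := conj_sym P (diag_mx (map_mx f d)).
have cD := is_derive_rotation K1 K2 x (d 0 i - d 0 j).
have ud : differentiable u (x + (d 0 i - d 0 j) *:
    ((cos 0 * sin 0) *: K1 - sin 0 ^+ 2 *: K2)).
  rewrite sin0 mulr0 expr0n !scale0r subr0 scaler0 addr0.
  by apply: du; exact: SPD_conj_diag.
have uD := is_derive_comp cD ud.
have FD := is_derive_rotation K1 K2 y (f (d 0 i) - f (d 0 j)).
rewrite [X in 'd u X]/= sin0 mulr0 expr0n !scale0r subr0 scaler0 addr0 linearZ in uD.
apply: (derive_unique _ uD FD) => t.
have cs1 : cos t ^+ 2 + sin t ^+ 2 = 1 by exact: cos2Dsin2.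
rewrite /= -conj_givens_shift -conj_diag_givens // univariate_conj_diag //; last first.
  exact: givens_mul_orthogonal.
by rewrite conj_diag_givens // !mxE.
Qed.

(** When d_i = d_j, a rotation in the plane (i, j) gives another eigenbasis of S.
    [diff_univariate_diag] in both bases determines the off-diagonal direction. *)
Lemma diff_univariate_double P d i j : P *m P^T = 1%:M ->
  (forall i, 0 < d 0 i) -> i != j -> d 0 i = d 0 j ->
  'd u (conj_sym P (diag_mx d)) (conj_sym P (delta_mx i j + delta_mx j i)) =
  'D_1 f (d 0 i) *: conj_sym P (delta_mx i j + delta_mx j i).
Proof.
(* Any rotation with c s <> 0 would do; this one is rational. *)
move=> PP d0 ij dij; pose c : R := 3 / 5; pose s : R := 4 / 5.
have cs1 : c ^+ 2 + s ^+ 2 = 1 by rewrite /c /s; field.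
have := diff_univariate_diag i (givens_mul_orthogonal ij cs1 PP) d0.
rewrite conj_diag_givens // dij subrr scale0r addr0.
rewrite -diag_mx_delta conj_diag_givens // diag_mx_delta !mxE !eqxx /= eq_sym (negbTE ij) subr0 scale1r.
rewrite conj_givens_shift.
have := diff_univariate_diag i PP d0; have := diff_univariate_diag j PP d0.
rewrite dij linearB /=.
move: ('d u _) => L; move: ('D_1 f _) => a.
move: (conj_sym P (delta_mx i i)) (conj_sym P (delta_mx j j)) => Ki Kj.
move: (conj_sym P _) => K Lj Li.
rewrite linearD linearB /= linearZ /= Li [L (_ *: (_ - _))]linearZ /= linearB /= Li Lj.
rewrite -scalerBr; move: (Ki - Kj) => Q; rewrite scalerDr scalerBr.
rewrite [s ^+ 2 *: (a *: _)]scalerA [s ^+ 2 * a]mulrC -[(a * _) *: _]scalerA.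
move=> /addrI/addIr H.
have cs0 : c * s != 0 by rewrite mulf_neq0 // mulf_neq0 // ?invr_eq0 pnatr_eq0.
by apply: (scalerI cs0); rewrite H !scalerA [a * _]mulrC.
Qed.

End UnivariateDiff.

(** * Divided differences and the Daleckii-Krein formula *)

Definition divided_difference (R : realType) (f : R -> R) (x y : R) : R :=
  if x == y then 'D_1 f x else (f x - f y) / (x - y).

Lemma divided_differenceC (R : realType) (f : R -> R) (x y : R) :
  divided_difference f x y = divided_difference f y x.
Proof.
rewrite /divided_difference eq_sym; case: eqVneq => [->//|_].
by rewrite -opprB -[x - y]opprB invrN mulrNN.
Qed.

Section PositiveHalfLine.
Variables (R : realType) (f : R -> R).
Hypothesis fd : diffeo_onto_image [set x : R | 0 < x] f.

Lemma diffeo_pos_differentiable (x : R) : 0 < x -> differentiable f x.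
Proof. by move=> x0; case: fd => /(_ 1)[+ _] _ _; exact. Qed.

Lemma diffeo_pos_derive_neq0 (x : R) : 0 < x -> 'D_1 f x != 0.
Proof.
move=> x0; have [_ _ [g sg gK]] := fd; apply/eqP => f0.
have dg : differentiable g (f x) by have [+ _] := sg 1; apply; exists x.
have H := derivative_of_inverse (@open_gt R 0) x0 gK (diffeo_pos_differentiable x0) dg 1.
have E : 'd f x 1 = 0 by rewrite -(deriveE _ (diffeo_pos_differentiable x0)).
have : (1 : R) = 'd g (f x) 0 := etrans (esym H) (congr1 ('d g (f x)) E).
by rewrite linear0 => /eqP; rewrite oner_eq0.
Qed.

Lemma diffeo_pos_derive_continuous (x : R) : 0 < x -> {for x, continuous ('D_1 f)}.
Proof. by move=> x0; case: fd => /(_ 1)[_ /(_ 1) +] _ _; apply. Qed.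

(** By the intermediate value theorem a change of sign of the continuous function f'
    would produce a zero. *)
Lemma diffeo_pos_derive_sign (x y : R) : 0 < x -> 0 < y -> 0 < 'D_1 f x * 'D_1 f y.
Proof.
wlog xy : x y / x <= y.
  move=> H x0 y0; case: (leP x y) => [|/ltW] xy; first exact: H.
  by rewrite mulrC; exact: H.
move=> x0 y0; rewrite ltNge; apply/negP => le0.
have cD : {within `[x, y], continuous ('D_1 f)}.
  apply: continuous_in_subspaceT => z; rewrite inE /= in_itv /= => /andP[xz _].
  exact: (diffeo_pos_derive_continuous (lt_le_trans x0 xz)).
have [|c] := @IVT R ('D_1 f) x y 0 xy cD.
  move: le0; move: ('D_1 f x) ('D_1 f y) => a b; rewrite ge_min le_max.
  case: (ltgtP a 0); case: (ltgtP b 0) => //= b0 a0; rewrite leNgt.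
    by rewrite nmulr_rgt0 ?b0.
  by rewrite mulr_gt0.
by rewrite in_itv /= => /andP[xc _] c0; have := diffeo_pos_derive_neq0 (lt_le_trans x0 xc);
  rewrite c0 eqxx.
Qed.

(** By the mean value theorem a divided difference is a value of f'. *)
Lemma divided_difference_sign (x y z : R) : 0 < x -> 0 < y -> 0 < z ->
  0 < divided_difference f x y * 'D_1 f z.
Proof.
wlog xy : x y / x <= y.
  move=> H x0 y0; case: (leP x y) => [|/ltW] xy; first exact: H.
  by rewrite divided_differenceC; exact: H.
move=> x0 y0 z0; rewrite /divided_difference; case: eqVneq => [_|xny].
  exact: diffeo_pos_derive_sign.
have {}xy : x < y by rewrite lt_neqAle xny.
have dI (c : R) : x <= c -> differentiable f c.
  by move=> xc; apply: diffeo_pos_differentiable; exact: lt_le_trans xc.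
have [||c] := @MVT R f ('D_1 f) x y xy.
- move=> c; rewrite in_itv /= => /andP[/ltW xc _].
  by apply: derivableP; apply/derivable1_diffP; exact: dI.
- apply: continuous_in_subspaceT => c; rewrite inE /= in_itv /= => /andP[xc _].
  exact: (differentiable_continuous (dI c xc)).
rewrite in_itv /= => /andP[xc _] E.
have -> : (f x - f y) / (x - y) = 'D_1 f c.
  by rewrite -opprB E -mulrN opprB mulfK // subr_eq0.
exact: (diffeo_pos_derive_sign (lt_trans x0 xc) z0).
Qed.

End PositiveHalfLine.

Section Loewner.
Variables (R : realType) (n : nat).
Local Notation sym := (sym R n).
Implicit Types (P E : 'M[R]_n) (d : 'rV[R]_n).

(** The entrywise product with the Loewner matrix of f at d. *)
Definition loewner_mul (f : R -> R) d E : 'M[R]_n :=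
  \matrix_(i, j) (divided_difference f (d 0 i) (d 0 j) * E i j).

Lemma loewner_mul_sym f d E : E^T = E -> (loewner_mul f d E)^T = loewner_mul f d E.
Proof.
move=> ET; apply/matrixP => i j; rewrite !mxE divided_differenceC.
by rewrite -{1}ET mxE.
Qed.

(** The Daleckii-Krein formula.  By linearity it is enough to treat the elementary
    matrices, that is [diff_univariate_diag], [diff_univariate_rotation] and
    [diff_univariate_double]. *)
Lemma diff_univariate (u : sym -> sym) (f : R -> R) P d E :
  univariate u f -> (forall S : sym, SPD S -> differentiable u S) ->
  (forall x : R, 0 < x -> differentiable f x) ->
  P *m P^T = 1%:M -> (forall i, 0 < d 0 i) ->
  'd u (conj_sym P (diag_mx d)) (conj_sym P E) = conj_sym P (loewner_mul f d E).
Proof.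
move=> uf du df PP d0.
have D1 := diff_univariate_diag uf du df _ PP d0.
have D2 i j ij := diff_univariate_rotation uf du (i := i) (j := j) PP d0 ij.
have D3 i j ij dij := diff_univariate_double uf du df (i := i) (j := j) PP d0 ij dij.
move: ('d u _) D1 D2 D3 => L D1 D2 D3.
have Ldelta i j : L (conj_sym P (delta_mx i j)) =
    divided_difference f (d 0 i) (d 0 j) *: conj_sym P (delta_mx i j).
  rewrite /divided_difference; have [<-|ij] := eqVneq i j; first by rewrite eqxx D1.
  have two : (2 : R) != 0 by rewrite pnatr_eq0.
  apply: (scalerI two); rewrite -linearZ /= scalerA [2 * _]mulrC -scalerA -!conj_sym_delta.
  case: eqVneq => [dij|dij]; first exact: D3.
  have dij0 : d 0 i - d 0 j != 0 by rewrite subr_eq0.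
  by apply: (scalerI dij0); rewrite D2 // scalerA mulrCA divff // mulr1.
rewrite {1}[E]matrix_sum_delta [loewner_mul f d E]matrix_sum_delta !linear_sum /=.
apply: eq_bigr => i _; rewrite !linear_sum /=; apply: eq_bigr => j _.
by rewrite !linearZ /= Ldelta mxE scalerA mulrC.
Qed.

Lemma conj_sym_conj (S : sym) P : P *m P^T = 1%:M ->
  conj_sym P (P^T *m symval S *m P) = S.
Proof.
move=> PP; rewrite /conj_sym !mulmxA PP mul1mx -mulmxA PP mulmx1.
exact: symvalK.
Qed.

Lemma inner_conj_sym P A B : P *m P^T = 1%:M -> A^T = A -> B^T = B ->
  sym_inner (conj_sym P A) (conj_sym P B) = \sum_i \sum_j A i j * B i j.
Proof.
move=> PP AT BT; rewrite /sym_inner !conj_symE //.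
have -> : P *m A *m P^T *m (P *m B *m P^T) = P *m (A *m B) *m P^T.
  by rewrite !mulmxA -(mulmxA (P *m A)) (mulmx1C PP) mulmx1.
rewrite mxtrace_mulC [P^T *m (P *m _)]mulmxA (mulmx1C PP) mul1mx.
apply: eq_bigr => i _; rewrite mxE; apply: eq_bigr => j _.
by rewrite -[in LHS]BT mxE.
Qed.

End Loewner.

(** * The balanced form *)

Section BalancedForm.
Variables (R : realType) (n : nat).
Local Notation sym := (sym R n).
Local Notation SPD := (@SPD R n).
Implicit Types (S X Y : sym).

Lemma sym_innerZ a b X Y : sym_inner (a *: X) (b *: Y) = a * b * sym_inner X Y.
Proof. by rewrite /sym_inner !symvalZ -scalemxAl -scalemxAr !mxtraceZ mulrA. Qed.

Lemma sym_inner_bilinear (L M : {linear sym -> sym}) (k : R) :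
  bilinear_for *%R *%R (fun X Y => k * sym_inner (L X) (M Y)).
Proof.
split=> [Y a X1 X2|X a Y1 Y2] /=; rewrite linearP /sym_inner symvalD symvalZ.
  by rewrite mulmxDl -scalemxAl mxtraceD mxtraceZ mulrDr mulrCA.
by rewrite mulmxDr -scalemxAr mxtraceD mxtraceZ mulrDr mulrCA.
Qed.

(** At the identity every entry of the Loewner matrix is f'(1). *)
Lemma diff_univariate_at1 (u : sym -> sym) (f : R -> R) X :
  univariate u f -> (forall S, SPD S -> differentiable u S) ->
  (forall x : R, 0 < x -> differentiable f x) ->
  'd u (sym1 R n) X = 'D_1 f 1 *: X.
Proof.
move=> uf du df; pose d : 'rV[R]_n := const_mx 1.
have PP : (1%:M : 'M[R]_n) *m 1%:M^T = 1%:M by rewrite trmx1 mulmx1.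
have d0 i : 0 < d 0 i by rewrite mxE.
have I1 : conj_sym 1%:M (diag_mx d) = sym1 R n.
  apply: symval_inj; rewrite conj_symE ?tr_diag_mx // mul1mx trmx1 mulmx1.
  by rewrite diag_const_mx.
have XE : conj_sym 1%:M (symval X) = X.
  by rewrite -[RHS](conj_sym_conj X PP) trmx1 mul1mx mulmx1.
have := diff_univariate (symval X) uf du df PP d0.
rewrite I1 XE => ->; rewrite -[in RHS]XE -linearZ /=; congr (conj_sym _ _).
by apply/matrixP => i j; rewrite !mxE /divided_difference eqxx.
Qed.

Lemma transport_univariate (u : sym -> sym) :
  univariate_diffeo u -> exists f : R -> R,
  [/\ univariate u f, forall S, SPD S -> differentiable u S,
      smooth_on SPD u, diffeo_onto_image [set x : R | 0 < x] f &
      forall S X, SPD S ->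
        transport (deformed_euclidean u) S (sym1 R n) X = ('D_1 f 1)^-1 *: 'D_X u S].
Proof.
move=> [f [uf [su oV [w sw uK]] fd]]; exists f.
have du S : SPD S -> differentiable u S by exact: pullback_diff.
have df (x : R) : 0 < x -> differentiable f x by exact: diffeo_pos_differentiable.
have f1 : 'D_1 f 1 != 0 by exact: diffeo_pos_derive_neq0.
have inv A : 'd w (u (sym1 R n)) A = ('D_1 f 1)^-1 *: A.
  have E : 'd u (sym1 R n) (('D_1 f 1)^-1 *: A) = A.
    by rewrite (diff_univariate_at1 _ uf du df) scalerA divff // scale1r.
  exact: (etrans (congr1 _ (esym E)) (pullback_dK su sw uK _ (@SPD1 R n))).
split=> // S X HS; rewrite (transport_pullback su oV sw uK X HS (@SPD1 R n)).
by rewrite (deriveE _ (du S HS)); exact: inv.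
Qed.

(** The coordinates E X are the entries of X in an eigenbasis of S, and the weights
    K are products of divided differences of f and h normalized by f'(1) and
    h'(1).  One diagonal formula serves the symmetry and the positivity. *)
Lemma balanced_form_diagonal (u v : sym -> sym) (f h : R -> R) S :
  univariate u f -> univariate v h ->
  (forall S, SPD S -> differentiable u S) -> (forall S, SPD S -> differentiable v S) ->
  diffeo_onto_image [set x : R | 0 < x] f -> diffeo_onto_image [set x : R | 0 < x] h ->
  SPD S -> exists K : 'M[R]_n, exists E : sym -> 'M[R]_n,
   [/\ forall i j, 0 < K i j, forall X, E X = 0 -> X = 0 &
      forall X Y, ('D_1 f 1)^-1 * ('D_1 h 1)^-1 * sym_inner ('D_X u S) ('D_Y v S) =
        \sum_i \sum_j K i j * (E X i j * E Y i j)].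
Proof.
move=> uf vh du dv fd hd HS; have [P [d [PP SE d0]]] := SPD_spectralP HS.
have df (x : R) : 0 < x -> differentiable f x by exact: diffeo_pos_differentiable.
have dh (x : R) : 0 < x -> differentiable h x by exact: diffeo_pos_differentiable.
have -> : S = conj_sym P (diag_mx d).
  by apply: symval_inj; rewrite conj_symE ?tr_diag_mx.
have Hd := SPD_conj_diag PP d0.
pose E X := P^T *m symval X *m P.
have ET X : (E X)^T = E X by rewrite /E !trmx_mul trmxK symvalT mulmxA.
have EK X : conj_sym P (E X) = X by exact: conj_sym_conj.
pose a := 'D_1 f 1; pose b := 'D_1 h 1.
have sa : 0 < a * a by exact: diffeo_pos_derive_sign.
have sb : 0 < b * b by exact: diffeo_pos_derive_sign.
exists (\matrix_(i, j) (a^-1 * b^-1 *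
  (divided_difference f (d 0 i) (d 0 j) * divided_difference h (d 0 i) (d 0 j)))).
exists E; split.
- move=> i j; rewrite mxE.
  have pf : 0 < divided_difference f (d 0 i) (d 0 j) * a by exact: divided_difference_sign.
  have ph : 0 < divided_difference h (d 0 i) (d 0 j) * b by exact: divided_difference_sign.
  have a0 : a != 0 by apply: contraTneq sa => ->; rewrite mul0r ltxx.
  have b0 : b != 0 by apply: contraTneq sb => ->; rewrite mul0r ltxx.
  (* Each factor is compared with the derivative at 1, whose sign it has. *)
  have E1 (p q a' b' : R) : a' != 0 -> b' != 0 ->
      a'^-1 * b'^-1 * (p * q) = (p * a') * (q * b') / (a' * a' * (b' * b')).
    by move=> a'0 b'0; field; rewrite ?a'0 ?b'0.
  by rewrite (E1 _ _ _ _ a0 b0) divr_gt0 // mulr_gt0.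
- by move=> X EX; rewrite -[X]EK EX linear0.
- move=> X Y.
  have Eu := etrans (deriveE X (du _ Hd)) (etrans (congr1 ('d u _) (esym (EK X)))
    (diff_univariate (E X) uf du df PP d0)).
  have Ev := etrans (deriveE Y (dv _ Hd)) (etrans (congr1 ('d v _) (esym (EK Y)))
    (diff_univariate (E Y) vh dv dh PP d0)).
  rewrite Eu Ev.
  rewrite inner_conj_sym ?loewner_mul_sym // mulr_sumr; apply: eq_bigr => i _.
  rewrite mulr_sumr; apply: eq_bigr => j _; rewrite !mxE -/a -/b; ring.
Qed.

End BalancedForm.

Theorem theorem4p2 (R : realType) (n : nat) (hn : (0 < n)%N)
    (u v : sym R n -> sym R n)
    (hu : univariate_diffeo u) (hv : univariate_diffeo v) :
  riemannian_metric
    (balanced_form (deformed_euclidean u) (deformed_euclidean v)).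
Proof.
have [f [uf du su fd Tu]] := transport_univariate hu.
have [h [vh dv sv hd Tv]] := transport_univariate hv.
have gE (S X Y : sym R n) : SPD S ->
    balanced_form (deformed_euclidean u) (deformed_euclidean v) S X Y =
    ('D_1 f 1)^-1 * ('D_1 h 1)^-1 * sym_inner ('D_X u S) ('D_Y v S).
  move=> HS; apply: (etrans (congr2 (@sym_inner R n) (Tu S X HS) (Tv S Y HS))).
  exact: sym_innerZ.
have diag S := balanced_form_diagonal (S := S) uf vh du dv fd hd.
split.
- move=> S HS.
  have -> : balanced_form (deformed_euclidean u) (deformed_euclidean v) S =
      fun X Y => ('D_1 f 1)^-1 * ('D_1 h 1)^-1 * sym_inner ('d u S X) ('d v S Y).
    apply/funext => X; apply/funext => Y; apply: (etrans (gE S X Y HS)).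
    exact: (congr2 (fun A B => _ * sym_inner A B) (deriveE X (du S HS)) (deriveE Y (dv S HS))).
  exact: sym_inner_bilinear.
- move=> S X Y HS; have [K [E [K0 E0 H]]] := diag S HS.
  apply: (etrans (etrans (gE S X Y HS) (H X Y))).
  apply: (etrans _ (esym (etrans (gE S Y X HS) (H Y X)))).
  by apply: eq_bigr => i _; apply: eq_bigr => j _; rewrite [E X i j * _]mulrC.
- move=> S X HS X0; have [K [E [K0 E0 H]]] := diag S HS.
  have t0 i j : 0 <= K i j * (E X i j * E X i j).
    by apply: mulr_ge0; [exact: ltW|rewrite -expr2 sqr_ge0].
  rewrite (etrans (gE S X X HS) (H X X)) lt0r sumr_ge0 ?andbT => [|i _]; last first.
    by apply: sumr_ge0 => j _; exact: t0.
  apply: contra X0; rewrite psumr_eq0 => [/allP Hi|i _]; last first.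
    by apply: sumr_ge0 => j _; exact: t0.
  apply/eqP/E0/matrixP => i j; have := Hi i; rewrite mem_index_enum => /(_ isT) /=.
  rewrite psumr_eq0 => [/allP/(_ j)|k _]; last exact: t0.
  rewrite mem_index_enum => /(_ isT) /=.
  by rewrite mulf_eq0 gt_eqF //= mulf_eq0 orbb mxE => /eqP.
- move=> X Y k; apply: (@Ck_ext _ _ _ _ _ (fun S => \sum_(ij : 'I_n * 'I_n)
     (('D_1 f 1)^-1 * ('D_1 h 1)^-1) *
     (sym_entry ij.1 ij.2 ('D_X u S) * sym_entry ij.1 ij.2 ('D_Y v S)))).
  + exact: open_SPD.
  + by move=> S HS; apply/esym/(etrans (gE S X Y HS)); rewrite sym_innerE mulr_sumr.
  + apply: Ck_sum; first exact: open_SPD.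
    move=> ij; apply: CkM; [exact: open_SPD|exact: Ck_cst|].
    have [_ /(_ X) cu] := su k.+1; have [_ /(_ Y) cv] := sv k.+1.
    apply: CkM; first exact: open_SPD.
      apply: (Ck_linear (f := 'D_X u)); [exact: open_SPD|exact: continuous_sym_entry|exact: cu].
    apply: (Ck_linear (f := 'D_Y v)); [exact: open_SPD|exact: continuous_sym_entry|exact: cv].
Qed.
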